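(* There is a positive existential interpretation of the semiring $(\mathbb{N};0,1,+,\times,=)$ in the $\mathscr{L}_h$-structure $\mathfrak{Q}$, where $\mathfrak{Q}$ is the field $\mathbb{Q}$ expanded by all the height comparison relations $H_{m,n}$, $m,n\ge 1$.
   Context: $\mathbb{N}=\{0,1,2,\dots\}$. Heights: for $\mathbf{q}=(q_1,\dots,q_m)\in\mathbb{Q}^m$ with $m\ge 1$, $h_m(\mathbf{q})=\log\max\{d,|dq_1|,\dots,|dq_m|\}$, where $d\ge 1$ is the least common denominator of the $q_j$. For $m,n\ge 1$, $\mathbf{x}\in\mathbb{Q}^m$ and $\mathbf{y}\in\mathbb{Q}^n$, the relation $H_{m,n}(\mathbf{x},\mathbf{y})$ on $\mathbb{Q}^m\times\mathbb{Q}^n$ holds if and only if $h_m(\mathbf{x})\le h_n(\mathbf{y})$. The first order language $\mathscr{L}_h$ consists of constant symbols $0,1$, binary function symbols $+,\times$, the relation symbol $=$, and an $(m+n)$-ary relation symbol $H_{m,n}$ for each $m,n\ge 1$. $\mathfrak{Q}$ is the $\mathscr{L}_h$-structure with base set $\mathbb{Q}$ in which all symbols have the obvious interpretation. A positive existential formula is one built from atomic formulas using only $\wedge$, $\vee$ and existential quantifiers (no negation). Interpretations: let $\mathscr{L}_1,\mathscr{L}_2$ be first order languages and $\mathfrak{M}_1,\mathfrak{M}_2$ structures over them with base sets $M_1,M_2$. For an $\mathscr{L}_2$-formula $\phi$, $\phi^{\mathfrak{M}_2}$ denotes its realization in $\mathfrak{M}_2$. An interpretation of rank $r$ of $\mathfrak{M}_1$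 in $\mathfrak{M}_2$ consists of: (i) an $\mathscr{L}_2$-formula $\phi_{\mathscr{L}_1}$ with $r$ free variables; (ii) a function $\theta:\phi_{\mathscr{L}_1}^{\mathfrak{M}_2}\to M_1$; (iii) for each $s\in\mathscr{L}_1$ an $\mathscr{L}_2$-formula $\phi_s$; such that: (a) $\theta$ is surjective onto $M_1$; (b) $\phi_c^{\mathfrak{M}_2}\subseteq\phi_{\mathscr{L}_1}^{\mathfrak{M}_2}$ and $\theta^{-1}(c^{\mathfrak{M}_1})=\phi_c^{\mathfrak{M}_2}$ for each constant symbol $c\in\mathscr{L}_1$; (c) $\phi_R^{\mathfrak{M}_2}\subseteq(\phi_{\mathscr{L}_1}^{\mathfrak{M}_2})^n$ and $(\theta^n)^{-1}(R^{\mathfrak{M}_1})=\phi_R^{\mathfrak{M}_2}$ for each $n$-ary relation symbol $R\in\mathscr{L}_1$ (including $=$ when it is listed in the language); (d) $\phi_f^{\mathfrak{M}_2}\subseteq(\phi_{\mathscr{L}_1}^{\mathfrak{M}_2})^{n+1}$ and $(\theta^{n+1})^{-1}(f^{\mathfrak{M}_1})=\phi_f^{\mathfrak{M}_2}$ for each $n$-ary function symbol $f\in\mathscr{L}_1$, where $f^{\mathfrak{M}_1}$ is identified with its graph. Here $\theta^k:(\phi_{\mathscr{L}_1}^{\mathfrak{M}_2})^k\to M_1^k$ is the map given by $k$ copies of $\theta$. The interpretation is positive existential if $\phi_{\mathscr{L}_1}$ and all formulas $\phi_s$, $s\in\mathscr{L}_1$, are positive existential. *)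

(* Defs.v *)
From mathcomp Require Import all_boot all_order all_algebra.
From mathcomp Require Import reals exp.

Set Implicit Arguments.
Unset Strict Implicit.
Unset Printing Implicit Defensive.

Import Order.TTheory GRing.Theory Num.Theory.

Local Open Scope ring_scope.

(** * First order languages, formulas and structures *)

(** Equality is not a logical primitive: it is a binary relation symbol,
    available only in the languages that list it. *)
Record language := Language {
  csym : Type;
  fsym : Type;
  farity : fsym -> nat;
  rsym : Type;
  rarity : rsym -> nat
}.

Inductive term (L : language) (V : Type) : Type :=
| TVar (v : V)
| TConst (c : csym L)
| TFun (f : fsym L) (args : 'I_(farity f) -> term L V).
Arguments TVar {L V} v.
Arguments TConst {L V} c.
Arguments TFun {L V} f args.

(** [formula L V] is the type of first order [L]-formulas with free variables
    in [V].  The variable bound by a quantifier is [None : option V]. *)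
Inductive formula (L : language) (V : Type) : Type :=
| FRel (s : rsym L) (args : 'I_(rarity s) -> term L V)
| FNot (p : formula L V)
| FAnd (p q : formula L V)
| FOr (p q : formula L V)
| FImp (p q : formula L V)
| FEx (p : formula L (option V))
| FAll (p : formula L (option V)).

Fixpoint pos_exist (L : language) (V : Type) (p : formula L V) : Prop :=
  match p with
  | FRel _ _ => True
  | FAnd p q => pos_exist p /\ pos_exist q
  | FOr p q => pos_exist p /\ pos_exist q
  | FEx p => pos_exist p
  | FNot _ | FImp _ _ | FAll _ => False
  end.

Record structure (L : language) := Structure {
  base :> Type;
  cinterp : csym L -> base;
  finterp : forall f : fsym L, ('I_(farity f) -> base) -> base;
  rinterp : forall s : rsym L, ('I_(rarity s) -> base) -> Prop
}.

Fixpoint teval (L : language) (M : structure L) (V : Type) (e : V -> M)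
    (t : term L V) : M :=
  match t with
  | TVar v => e v
  | TConst c => cinterp M c
  | TFun f args => finterp (fun i => teval e (args i))
  end.

Definition extend (M V : Type) (e : V -> M) (a : M) : option V -> M :=
  fun o => if o is Some v then e v else a.

(** The realization of [p] in [M], as a subset of [V -> M]. *)
Fixpoint realization (L : language) (M : structure L) (V : Type)
    (p : formula L V) : (V -> M) -> Prop :=
  match p with
  | FRel s args => fun e => rinterp (fun i => teval e (args i))
  | FNot p => fun e => ~ realization p e
  | FAnd p q => fun e => realization p e /\ realization q e
  | FOr p q => fun e => realization p e \/ realization q e
  | FImp p q => fun e => realization p e -> realization q e
  | FEx p => fun e => exists a : M, realization p (extend e a)
  | FAll p => fun e => forall a : M, realization p (extend e a)
  end.

(** * Interpretations *)

(** A point of [(M^r)^k] is a map ['I_k -> 'I_r -> M]; accordingly a formula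
    defining a subset of it has its free variables in ['I_k * 'I_r]. *)
Definition flat (M : Type) (k r : nat) (x : 'I_k -> 'I_r -> M) :
    'I_k * 'I_r -> M :=
  fun v => x v.1 v.2.

(** The graph of an operation; the value is the last coordinate. *)
Definition graph (M : Type) (k : nat) (f : ('I_k -> M) -> M)
    (z : 'I_k.+1 -> M) : Prop :=
  f (fun i => z (widen_ord (leqnSn k) i)) = z ord_max.

(** [preimage_cond D theta phi S] says that [phi] defines a subset of [D^k]
    which is the preimage of [S] under [theta^k : D^k -> M1^k]. *)
Definition preimage_cond (L2 : language) (M2 : structure L2) (M1 : Type)
    (r k : nat) (D : ('I_r -> M2) -> Prop) (theta : {x | D x} -> M1)
    (phi : formula L2 ('I_k * 'I_r)) (S : ('I_k -> M1) -> Prop) : Prop :=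
  (forall x : 'I_k -> 'I_r -> M2,
      realization phi (flat x) -> forall i, D (x i)) /\
  (forall x : 'I_k -> {x | D x},
      S (fun i => theta (x i)) <->
      realization phi (flat (fun i => proj1_sig (x i)))).

Record interpretation (L1 L2 : language) (M1 : structure L1)
    (M2 : structure L2) (r : nat) := Interpretation {
  phi_dom : formula L2 'I_r;
  theta : {x : 'I_r -> M2 | realization phi_dom x} -> M1;
  phi_const : csym L1 -> formula L2 'I_r;
  phi_rel : forall s : rsym L1, formula L2 ('I_(rarity s) * 'I_r);
  phi_fun : forall f : fsym L1, formula L2 ('I_(farity f).+1 * 'I_r);
  theta_surj : forall a : M1, exists x, theta x = a;
  phi_constP : forall c : csym L1,
    (forall x : 'I_r -> M2,
        realization (phi_const c) x -> realization phi_dom x) /\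
    (forall x, theta x = cinterp M1 c <->
        realization (phi_const c) (proj1_sig x));
  phi_relP : forall s : rsym L1,
    preimage_cond theta (phi_rel s) (@rinterp L1 M1 s);
  phi_funP : forall f : fsym L1,
    preimage_cond theta (phi_fun f) (graph (@finterp L1 M1 f))
}.

Definition pos_exist_interpretation (L1 L2 : language) (M1 : structure L1)
    (M2 : structure L2) (r : nat) (I : interpretation M1 M2 r) : Prop :=
  [/\ pos_exist (phi_dom I),
      forall c, pos_exist (phi_const I c),
      forall s, pos_exist (phi_rel I s) &
      forall f, pos_exist (phi_fun I f)].

(** * The semiring of natural numbers *)

Inductive ring_const := Zero | One.
Inductive ring_op := Add | Mul.
Inductive eq_symbol := Eq.

Definition semiring_language : language :=
  @Language ring_const ring_op (fun _ => 2%N) eq_symbol (fun _ => 2%N).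

Definition nat_structure : structure semiring_language :=
  @Structure semiring_language nat
    (fun c : ring_const => match c with Zero => 0%N | One => 1%N end)
    (fun (f : ring_op) (x : 'I_2 -> nat) =>
       match f with
       | Add => (x ord0 + x ord_max)%N
       | Mul => (x ord0 * x ord_max)%N
       end)
    (fun (_ : eq_symbol) (x : 'I_2 -> nat) => x ord0 = x ord_max).

(** * The rationals with height comparison *)

Definition common_denom (m : nat) (q : 'I_m -> rat) : nat :=
  \big[lcmn/1%N]_(j < m) `|denq (q j)|%N.

Definition height (R : realType) (m : nat) (q : 'I_m -> rat) : R :=
  let d : rat := (common_denom q)%:R in
  ln (ratr (\big[Num.max/d]_(j < m) `|d * q j|)).

(** [HeightLe m n] is the symbol $H_{m+1,n+1}$: both indices are at least 1. *)
Inductive height_rel := HEq | HeightLe (m n : nat).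

Definition height_rel_arity (s : height_rel) : nat :=
  match s with
  | HEq => 2
  | HeightLe m n => m.+1 + n.+1
  end.

Definition height_language : language :=
  @Language ring_const ring_op (fun _ => 2%N) height_rel height_rel_arity.

Definition rat_height_structure (R : realType) : structure height_language :=
  @Structure height_language rat
    (fun c : ring_const => match c with Zero => 0 | One => 1 end)
    (fun (f : ring_op) (x : 'I_2 -> rat) =>
       match f with
       | Add => x ord0 + x ord_max
       | Mul => x ord0 * x ord_max
       end)
    (fun s : height_rel =>
       match s return ('I_(height_rel_arity s) -> rat) -> Prop with
       | HEq => fun x => x ord0 = x ord_max
       | HeightLe m n => fun x =>
           height R (fun i : 'I_m.+1 => x (lshift n.+1 i))
             <= height R (fun j : 'I_n.+1 => x (rshift m.+1 j))
       end).

(* Main.v *)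
(** The rational points of the Jacobi quartic [v^2 = 1 + 8 u^4] form a group
    under Euler's addition law, which is complete because 8 is not a square.
    A descent shows that this group is generated by [P = (1, 3)] and by the
    2-torsion point [T = (0, -1)]; since adding [T] or taking the opposite only
    changes signs, the rationals [u] for which [1 + 8 u^4] is a square are
    exactly the [± u(nP)], and [u] serves as a code for [n].

    The height of [(x, y, xy)] is the product of the heights of [x] and [y]
    (Segre embedding), and the heights [H] of the first coordinates satisfy
    [H(p+q) H(p-q) ~ H(p)^2 H(q)^2] up to a factor 9.  So [log H(nP)] is
    [c n^2 + O(1)], and comparing heights of tuples at the multiples [16n]
    decides exactly whether [a^2 + b^2 <= c^2 + d^2].  The group law gives
    [± n ± m], the order removes the ambiguity of signs, and multiplication is
    [xy = z <-> (x+y)^2 + (z-1)^2 = (x-y)^2 + (z+1)^2]. *)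

Require Import Defs.
From HB Require Import structures.
From mathcomp Require Import all_boot all_order all_algebra.
From mathcomp Require Import reals exp.
From mathcomp Require Import zify ring lra.

Set Implicit Arguments.
Unset Strict Implicit.
Unset Printing Implicit Defensive.

Import Order.TTheory GRing.Theory Num.Theory.

Local Open Scope ring_scope.

(** * The group law on the quartic *)

(** The 2-adic valuations of the two sides differ in parity. This irrationality serves twice: to
    make the addition law complete, and to exclude one case of the 2-descent. *)
Lemma rat_sqr_neq2 (x : rat) : x ^+ 2 != 2.
Proof.
apply/eqP => h.
have e : (numq x) ^+ 2 = 2 * (denq x) ^+ 2.
  apply: (@intr_inj rat); rewrite !expr2 !intrM -[2%:~R]h numqE.
  by ring.
have {}e : (`|numq x| ^ 2 = 2 * `|denq x| ^ 2)%N.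
  by have := congr1 absz e; rewrite abszM !abszX.
have /(congr1 odd) := congr1 (logn 2) e.
rewrite lognM ?expn_gt0 ?absz_gt0 ?denq_eq0 // !lognX (@logn_prime 2 2) //=.
by rewrite oddM /= oddM.
Qed.

Definition add_den (F : fieldType) (p q : F * F) : F :=
  1 - 8 * p.1 ^+ 2 * q.1 ^+ 2.

Definition add_coords (F : fieldType) (p q : F * F) : F * F :=
  ((p.1 * q.2 + q.1 * p.2) / add_den p q,
   ((1 + 8 * p.1 ^+ 2 * q.1 ^+ 2) * (p.2 * q.2)
     + 16 * (p.1 * q.1) * (p.1 ^+ 2 + q.1 ^+ 2)) / add_den p q ^+ 2).

Lemma add_coords_quartic (F : fieldType) (p q : F * F) :
  add_den p q != 0 ->
  p.2 ^+ 2 = 1 + 8 * p.1 ^+ 4 -> q.2 ^+ 2 = 1 + 8 * q.1 ^+ 4 ->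
  (add_coords p q).2 ^+ 2 = 1 + 8 * (add_coords p q).1 ^+ 4.
Proof.
case: p q => [u1 v1] [u2 v2]; rewrite /add_coords /add_den /= => D h1 h2.
by field: h1 h2.
Qed.

Lemma add_coordsA (F : fieldType) (p q r : F * F) :
  add_den p q != 0 -> add_den q r != 0 ->
  add_den p (add_coords q r) != 0 -> add_den (add_coords p q) r != 0 ->
  p.2 ^+ 2 = 1 + 8 * p.1 ^+ 4 -> q.2 ^+ 2 = 1 + 8 * q.1 ^+ 4 ->
  r.2 ^+ 2 = 1 + 8 * r.1 ^+ 4 ->
  add_coords p (add_coords q r) = add_coords (add_coords p q) r.
Proof.
move=> Dpq Dqr Dp Dr hp hq hr.
(* Only the outer additions are unfolded and cross-multiplied, so that [field] has to invert nothing
   but the two inner denominators. *)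
rewrite {1 4}/add_coords; congr pair; apply/eqP;
  rewrite eqr_div ?expf_neq0 //; apply/eqP; clear Dp Dr.
- case: p q r => [u1 v1] [u2 v2] [u3 v3] in Dpq Dqr hp hq hr *.
  by rewrite /add_coords /add_den /= in Dpq Dqr hp hq hr *; field: hp hq hr; exact/andP.
- case: p q r => [u1 v1] [u2 v2] [u3 v3] in Dpq Dqr hp hq hr *.
  by rewrite /add_coords /add_den /= in Dpq Dqr hp hq hr *; field: hp hq hr; exact/andP.
Qed.

Lemma add_coordsC (F : fieldType) (p q : F * F) :
  add_coords p q = add_coords q p.
Proof. by rewrite /add_coords /add_den; congr (_ / _, _ / _); ring. Qed.

Lemma add0_coords (F : fieldType) (p : F * F) : add_coords (0, 1) p = p.
Proof.
case: p => u v; rewrite /add_coords /add_den /= expr0n !(mulr0, mul0r) subr0.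
by congr pair; rewrite !(add0r, addr0, mulr1, mul1r, expr1n, divr1).
Qed.

Lemma addN_coords (F : fieldType) (p : F * F) :
  add_den (- p.1, p.2) p != 0 -> p.2 ^+ 2 = 1 + 8 * p.1 ^+ 4 ->
  add_coords (- p.1, p.2) p = (0, 1).
Proof.
case: p => u v; rewrite /add_coords /add_den /= => D h.
by congr pair; field: h.
Qed.

(** A zero would make [4 * p.1 * q.1] a rational square root of 2. Hence the addition formula has no
    exceptional pairs over the rationals. *)
Lemma add_den_neq0 (p q : rat * rat) : add_den p q != 0.
Proof.
apply/eqP => /eqP; rewrite /add_den subr_eq0 => /eqP e.
have /eqP[] := rat_sqr_neq2 (4 * p.1 * q.1); 
transitivity (2 * (8 * p.1 ^+ 2 * q.1 ^+ 2)); [ring | by rewrite -e mulr1].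
Qed.

Definition on_quartic (p : rat * rat) : bool := p.2 ^+ 2 == 1 + 8 * p.1 ^+ 4.

Record point := Point { coords :> rat * rat; pointP : on_quartic coords }.

HB.instance Definition _ := [isSub for coords].
HB.instance Definition _ := [Choice of point by <:].

Lemma quartic_eq (p : point) : p.2 ^+ 2 = 1 + 8 * p.1 ^+ 4.
Proof. exact/eqP/pointP. Qed.

Lemma point_eq (p q : point) : p.1 = q.1 -> p.2 = q.2 -> p = q.
Proof.
move=> e1 e2; apply: val_inj => /=.
by rewrite [coords p]surjective_pairing e1 e2 -surjective_pairing.
Qed.

Fact zero_on_quartic : on_quartic (0, 1).
Proof. by []. Qed.

Fact opp_on_quartic (p : point) : on_quartic (- p.1, p.2).
Proof. by apply/eqP => /=; ring: (quartic_eq p). Qed.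

Fact add_on_quartic (p q : point) : on_quartic (add_coords p q).
Proof.
apply/eqP/add_coords_quartic; [exact: add_den_neq0 | exact: quartic_eq..].
Qed.

Definition point_zero := Point zero_on_quartic.
Definition point_opp p := Point (opp_on_quartic p).
Definition point_add p q := Point (add_on_quartic p q).

Fact point_addA : associative point_add.
Proof.
by move=> p q r; apply: val_inj; apply: add_coordsA;
  first [exact: add_den_neq0 | exact: quartic_eq].
Qed.

Fact point_addC : commutative point_add.
Proof.
by move=> p q; apply: val_inj; apply: add_coordsC.
Qed.

Fact point_add0 : left_id point_zero point_add.
Proof.
by move=> p; apply: val_inj; apply: add0_coords.
Qed.

Fact point_addN : left_inverse point_zero point_opp point_add.
Proof.
move=> p; apply: val_inj; apply: addN_coords; last exact: quartic_eq.
exact: add_den_neq0.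
Qed.

HB.instance Definition _ :=
  GRing.isZmodule.Build point point_addA point_addC point_add0 point_addN.

Lemma pointNE (p : point) : coords (- p) = (- p.1, p.2).
Proof. by []. Qed.

Lemma pointDE (p q : point) : coords (p + q) = add_coords p q.
Proof. by []. Qed.

Fact tors_on_quartic : on_quartic (0, -1).
Proof. by []. Qed.

Fact gen_on_quartic : on_quartic (1, 3).
Proof. by []. Qed.

Definition tors : point := Point tors_on_quartic.
Definition gen : point := Point gen_on_quartic.

Lemma addr_tors (p : point) : coords (p + tors) = (- p.1, - p.2).
Proof.
rewrite pointDE /add_coords /add_den /= expr0n mulr0 subr0.
by congr pair; field.
Qed.

Lemma tors2 : tors + tors = 0.
Proof. by apply: point_eq; rewrite addr_tors. Qed.

Lemma tors_addb (t t' : bool) : tors *+ t + tors *+ t' = tors *+ (t (+) t').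
Proof.
by case: t t' => [] []; rewrite ?mulr0n ?mulr1n ?addr0 ?add0r ?tors2.
Qed.

(** The curve equation makes the second coordinates agree up to sign too, and the four sign patterns
    are realized by the opposite and by translation by [tors]. *)
Lemma sqr_fst_eq (p q : point) : p.1 ^+ 2 = q.1 ^+ 2 ->
  exists s t : bool, p = (if s then - q else q) + tors *+ t.
Proof.
move=> e1; have e2 : p.2 ^+ 2 = q.2 ^+ 2.
  by rewrite !quartic_eq; ring: e1.
have /orP[/eqP h1|/eqP h1] : (p.1 == q.1) || (p.1 == - q.1) by rewrite -eqf_sqr e1.
- have /orP[/eqP h2|/eqP h2] : (p.2 == q.2) || (p.2 == - q.2) by rewrite -eqf_sqr e2.
  + by exists false, false; rewrite mulr0n addr0; apply: point_eq.
  + exists true, true; rewrite mulr1n; apply: point_eq; rewrite addr_tors pointNE //=.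
    by rewrite opprK.
- have /orP[/eqP h2|/eqP h2] : (p.2 == q.2) || (p.2 == - q.2) by rewrite -eqf_sqr e2.
  + by exists true, false; rewrite mulr0n addr0; apply: point_eq.
  + by exists false, true; rewrite mulr1n; apply: point_eq; rewrite addr_tors.
Qed.

Lemma sqr_fst_tors (p : point) (s t : bool) :
  ((if s then - p else p) + tors *+ t).1 ^+ 2 = p.1 ^+ 2.
Proof.
case: t; rewrite ?mulr1n ?mulr0n ?addr0 ?addr_tors; case: s; rewrite ?pointNE /=; ring.
Qed.

(** * Two-descent over the natural numbers *)

Section NatDescent.
Local Open Scope nat_scope.

Lemma coprime_mul_sqr m n k : coprime m n -> m * n = k ^ 2 ->
  exists x y, [/\ m = x ^ 2, n = y ^ 2 & k = x * y].
Proof.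
have sq a b c : coprime a b -> a * b = c ^ 2 -> a = gcdn a c ^ 2.
  (* The square of gcd(a, c) is gcd(a^2, ac, c^2), and c^2 = ab, so it equals a gcd(a, b, c) = a. *)
  move=> co e.
  suff: gcdn a c * gcdn a c = a * gcdn (gcdn a b) c.
    by rewrite (eqP co) gcd1n muln1 mulnn.
  rewrite !muln_gcdr !muln_gcdl e -mulnn [c * a]mulnC.
  by rewrite gcdnA -[gcdn (gcdn (a * a) _) (a * c)]gcdnA gcdnn gcdnAC.
move=> co e; exists (gcdn m k), (gcdn n k).
have em := sq _ _ _ co e.
have en : n = gcdn n k ^ 2 by apply: (sq _ m); rewrite 1?coprime_sym // mulnC.
split=> //; apply/eqP; rewrite -(@eqn_exp2r _ _ 2) // expnMn -em -en e.
exact/eqP.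
Qed.

Lemma coprime_mul_pow4 m n k : coprime m n -> m * n = k ^ 4 ->
  exists x y, [/\ m = x ^ 4, n = y ^ 4 & k = x * y].
Proof.
move=> co; rewrite -[4]/(2 * 2) expnM => /(coprime_mul_sqr co) [x [y [em en]]].
rewrite em en in co *; move=> /esym /coprime_mul_sqr [|a [b [-> -> ->]]].
  by move: co; rewrite coprime_pexpl ?coprime_pexpr.
by exists a, b; rewrite -!expnM.
Qed.

(** If [b] were even, [a] would be odd and [r] divisible by 4, so 16 would divide [8 * a ^ 4]. *)
Lemma quartic_odd a b r : coprime a b -> b ^ 4 + 8 * a ^ 4 = r ^ 2 -> odd b.
Proof.
move=> co e; apply/negPn/negP => evb.
have oa : odd a.
  case: (boolP (odd a)) => // eva; move: (co).
  have : 2 %| gcdn a b by rewrite dvdn_gcd !dvdn2 eva evb.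
  by move=> h /eqP h1; rewrite h1 in h.
have [c ec] : exists c, b = 2 * c by exists b./2; lia.
have half x : ~~ odd x -> exists y, x = 2 * y by exists x./2; lia.
have {}half x y : x ^ 2 = 2 * y -> exists z, x = 2 * z.
  by move=> h; apply: half; move: (congr1 odd h); rewrite oddX oddM => /= ->.
have [r1 e1] : exists z, r = 2 * z.
  by apply: (half _ (8 * c ^ 4 + 4 * a ^ 4)); rewrite -e ec expnMn; lia.
have [r2 e2] : exists z, r1 = 2 * z.
  by apply: (half _ (2 * c ^ 4 + a ^ 4)); move: e; rewrite ec e1 !expnMn; lia.
have : odd (a ^ 4) = false by move: e; rewrite ec e1 e2 !expnMn; lia.
by rewrite oddX oa.
Qed.

(* Factor [(r - b^2)(r + b^2) = 8 a^4]; when one factor yields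
   [t^4 = 2 s^4 + b^2], factor [(t^2 - b)(t^2 + b) = 2 s^4] once more.  The first
   alternative says that [± a / b] is the first coordinate of the double of
   [(l / k, t / k^2)]. *)
Lemma quartic_descent a b r : 0 < b -> coprime a b -> b ^ 4 + 8 * a ^ 4 = r ^ 2 ->
  (exists k l t, [/\ 0 < k, t ^ 2 = k ^ 4 + 8 * l ^ 4, a = 2 * t * k * l &
     b + 8 * l ^ 4 = k ^ 4 \/ b + k ^ 4 = 8 * l ^ 4]) \/
  (exists w, r + b ^ 2 = w ^ 2).
Proof.
move=> b0 co e; have ob := quartic_odd co e.
have co8 : coprime b (8 * a ^ 4).
  rewrite coprimeMr coprime_pexpr // [coprime b a]coprime_sym co andbT.
  by rewrite -[8]/(2 ^ 3) coprime_pexpr // coprimen2.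
have co2 : coprime b (2 * a ^ 4).
  rewrite coprimeMr coprime_pexpr // [coprime b a]coprime_sym co andbT.
  by rewrite coprimen2.
have lerb : b ^ 2 <= r.
  by rewrite -(@leq_exp2r _ _ 2) // -expnM -e leq_addr.
have oddr : odd r by move: (congr1 odd e); rewrite oddD oddM !oddX ob /= => <-.
have ob2 : odd (b ^ 2) by rewrite oddX ob.
have [m em] : exists m, r = 2 * m + b ^ 2.
  exists (r - b ^ 2)./2; lia.
have e2 : m * (m + b ^ 2) = 2 * a ^ 4.
  apply/eqP; rewrite -(@eqn_pmul2l 4) //; apply/eqP.
  move: e; rewrite em; have -> : b ^ 4 = b ^ 2 * b ^ 2 by rewrite -expnD.
  rewrite -mulnn; move: (b ^ 2) (a ^ 4) => B A; clear; lia.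
have com : coprime m (b ^ 2).
  rewrite coprime_pexpr // /coprime -dvdn1 -(eqP co2) dvdn_gcd dvdn_gcdr /= -e2.
  exact/dvdn_mulr/dvdn_gcdl.
have comn : coprime m (m + b ^ 2) by rewrite /coprime gcdnDl.
(* The coprime numbers [m] and [m + b ^ 2] have opposite parity, so the factor 2 of [2 * a ^ 4] lies
   in just one of them; halving that one leaves two coprime numbers whose product is a square. *)
case: (boolP (odd m)) => om; last first.
- left; have [m' em'] : exists m', m = 2 * m' by exists m./2; lia.
  have e3 : m' * (m + b ^ 2) = (a ^ 2) ^ 2.
    apply/eqP; rewrite -(@eqn_pmul2l 2) // -expnM mulnA -em' e2; exact/eqP.
  have com' : coprime m' (m + b ^ 2).
    by move: comn; rewrite {1}em' coprimeMl => /andP[].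
  have [s' [t' [es' et' est]]] := coprime_mul_sqr com' e3.
  have cost : coprime s' t' by move: com'; rewrite es' et' coprime_pexpl ?coprime_pexpr.
  have [s [t [es et ea]]] := coprime_mul_sqr cost (esym est).
  have e4 : t ^ 4 = 2 * s ^ 4 + b ^ 2.
    by rewrite -[4]/(2 * 2) !expnM -es -et -et' -es' em'.
  have ot : odd t.
    by move: (congr1 odd e4); rewrite oddD oddM !oddX ob /=.
  have ebt : b <= t ^ 2.
    by rewrite -(@leq_exp2r _ _ 2) // -expnM e4 leq_addl.
  have [f ef] : exists f, t ^ 2 = b + 2 * f.
    exists (t ^ 2 - b)./2; have : odd (t ^ 2) by rewrite oddX ot orbT. 
    move: (t ^ 2) ebt ob; clear; lia.
  have e5 : 2 * (f * (f + b)) = s ^ 4.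
    have : (t ^ 2) ^ 2 = 2 * s ^ 4 + b ^ 2 by rewrite -expnM.
    rewrite ef -!mulnn; move: (s ^ 4) => S; clear; lia.
  have [s1 es1] : exists s1, s = 2 * s1.
    exists s./2; rewrite mul2n even_halfK //.
    by move: (congr1 odd e5); rewrite oddM oddX /= => <-.
  have e6 : f * (f + b) = 8 * s1 ^ 4.
    by move: e5; rewrite es1 expnMn; move: (s1 ^ 4) => S; clear; lia.
  have cofb : coprime f (f + b).
    rewrite /coprime gcdnDl -dvdn1.
    have cob : coprime b (8 * s1 ^ 4).
      have /andP[cb8 _] : coprime b 8 && coprime b (a ^ 4) by rewrite -coprimeMr.
      have cbs : coprime b s1.
        by move: co; rewrite coprime_sym ea es1 !coprimeMr => /andP[/andP[]].
      by rewrite coprimeMr cb8 coprime_pexpr.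
    rewrite -(eqP cob) dvdn_gcd dvdn_gcdr /= -e6; exact/dvdn_mulr/dvdn_gcdl.
  (* The factor 8 lies wholly in the even one of the coprime numbers [f] and [f + b]; the remaining
     cofactors are fourth powers. *)
  case: (boolP (odd f)) => of_.
  + have [g eg] : exists g, f + b = 8 * g.
      have : 8 %| f + b.
        rewrite -(@Gauss_dvdr 8 f) ?e6 ?dvdn_mulr //.
        by rewrite -[8]/(2 ^ 3) coprime_pexpl // coprime2n.
      by case/dvdnP => g ->; exists g; rewrite mulnC.
    have [k [l [ek el ekl]]] : exists k l, [/\ f = k ^ 4, g = l ^ 4 & s1 = k * l].
      apply: coprime_mul_pow4.
        by move: cofb; rewrite eg coprimeMr => /andP[].
      by apply/eqP; rewrite -(@eqn_pmul2l 8) // -e6 eg mulnCA.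
    exists k, l, t; split; [| | |right].
    * by case: (k) ek => // ek; rewrite ek in of_.
    * by rewrite -ek -el -eg ef; clear; lia.
    * by rewrite ea es1 ekl; clear; ring.
    * by rewrite -ek -el -eg addnC.
  + have [g eg] : exists g, f = 8 * g.
      have : 8 %| f.
        rewrite -(@Gauss_dvdl 8 f (f + b)) ?e6 ?dvdn_mulr //.
        by rewrite -[8]/(2 ^ 3) coprime_pexpl // coprime2n oddD ob (negPf of_).
      by case/dvdnP => g ->; exists g; rewrite mulnC.
    have [k [l [ek el ekl]]] : exists k l, [/\ f + b = k ^ 4, g = l ^ 4 & s1 = k * l].
      apply: coprime_mul_pow4.
        move: cofb; rewrite {1}eg coprimeMl coprime_sym.
        by rewrite [coprime g _]coprime_sym => /andP[].
      by apply/eqP; rewrite -(@eqn_pmul2l 8) // -e6 mulnCA -eg mulnC.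
    exists k, l, t; split; [| | |left].
    * by case: (k) ek => // ek; move: b0 ek; clear; lia.
    * by rewrite -ek -el -eg ef; clear; lia.
    * by rewrite ea es1 ekl; clear; ring.
    * by rewrite -ek -el -eg addnC.
- right; have [n' en'] : exists n', m + b ^ 2 = 2 * n'.
    by exists (m + b ^ 2)./2; lia.
  have e3 : m * n' = (a ^ 2) ^ 2.
    apply/eqP; rewrite -(@eqn_pmul2l 2) // -expnM mulnCA -en' e2; exact/eqP.
  have com' : coprime m n' by move: comn; rewrite en' coprimeMr => /andP[].
  have [x [y [_ ey _]]] := coprime_mul_sqr com' e3.
  by exists (2 * y); rewrite expnMn -ey em; move: en'; clear; lia.
Qed.
End NatDescent.

(** * Heights of rational tuples *)

(** The multiplicative height of a single rational, kept as a natural number so that descent and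
    exact inequalities apply. *)
Definition ht (x : rat) : nat := maxn `|numq x| `|denq x|.

Lemma natr_maxn (F : numDomainType) (m n : nat) :
  (maxn m n)%:R = Num.max m%:R n%:R :> F.
Proof.
rewrite /maxn; case: ltnP => h; first by rewrite max_r // ler_nat ltnW.
by rewrite max_l // ler_nat.
Qed.

Lemma htE (x : rat) : (ht x)%:R = Num.max `|(numq x)%:~R| `|(denq x)%:~R| :> rat.
Proof. by rewrite natr_maxn !natr_absz !intr_norm.
Qed.

Lemma ht_gt0 x : (0 < ht x)%N.
Proof. by rewrite /ht leq_max !absz_gt0 denq_eq0 orbT. Qed.

Lemma denqr_neq0 (x : rat) : (denq x)%:~R != 0 :> rat.
Proof. by rewrite intr_eq0 denq_eq0. Qed.

Lemma numq_bezout (x : rat) : exists2 a : rat, a \is a Num.int &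
  exists2 b, b \is a Num.int & a * (numq x)%:~R + b * (denq x)%:~R = 1.
Proof.
have /coprimezP[[a b] /= e] : coprimez (numq x) (denq x) by apply: coprime_num_den.
exists a%:~R; first exact: intr_int.
by exists b%:~R; rewrite ?intr_int // -!intrM -intrD e.
Qed.

(* [(D, x D, y D, x y D)] is an integral multiple of the tensor product of the
   primitive integer vectors representing [(1 : x)] and [(1 : y)]. *)
Lemma segre_bound (x y D : rat) (B : nat) :
  D != 0 -> D \is a Num.int -> x * D \is a Num.int -> y * D \is a Num.int ->
  x * y * D \is a Num.int ->
  `|D| <= B%:R -> `|x * D| <= B%:R -> `|y * D| <= B%:R -> `|x * y * D| <= B%:R ->
  (ht x * ht y <= B)%N.
Proof.
move=> D0 iD iA iA' iN hD hA hA' hN.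
have [a ia [b ib e1]] := numq_bezout x.
have [c ic [d id e2]] := numq_bezout y.
have px := numqE x; have py := numqE y.
have qx0 := denqr_neq0 x; have qy0 := denqr_neq0 y.
(* Bezout for [x] and for [y] writes this multiplier as an integral combination of the four
   integers, so its absolute value is at least 1 and the primitive vector obeys the same bound. *)
pose l := D / ((denq x)%:~R * (denq y)%:~R).
have il : l \is a Num.int.
  have -> : l = a * c * (x * y * D) + a * d * (x * D) + b * c * (y * D) + b * d * D.
    transitivity (l * (a * (numq x)%:~R + b * (denq x)%:~R)
                    * (c * (numq y)%:~R + d * (denq y)%:~R)).
      by rewrite e1 e2 !mulr1.
    rewrite px py /l; field; exact/andP.
  by repeat (first [assumption | apply: rpredD | apply: rpredM]).
have l0 : l != 0 by rewrite mulf_neq0 ?invr_eq0 ?mulf_neq0.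
have l1 : 1 <= `|l| by rewrite norm_intr_ge1.
have DE : D = l * ((denq x)%:~R * (denq y)%:~R) by rewrite mulfVK ?mulf_neq0.
have le_scale (m C : rat) : l * m = C -> `|C| <= B%:R -> `|m| <= B%:R.
  by move=> <-; apply: le_trans; rewrite normrM ler_peMl.
rewrite -(ler_nat rat) natrM !htE.
have [_|_] := leP `|(numq x)%:~R : rat| _; have [_|_] := leP `|(numq y)%:~R : rat| _;
  rewrite -normrM.
- exact: le_scale hD.
- by apply: le_scale hA'; rewrite DE py; ring.
- by apply: le_scale hA; rewrite DE px; ring.
- by apply: le_scale hN; rewrite DE px py; ring.
Qed.

Lemma denq_dvdn (x : rat) (d : nat) : (`|denq x| %| d)%N = (d%:R * x \is a Num.int).
Proof.
apply/idP/idP => [/dvdnP[k ->]|/intrP[z e]].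
  rewrite natrM natr_absz gtr0_norm ?denq_gt0 // -mulrA [_%:~R * x]mulrC -numqE.
  by rewrite rpredM ?natr_int ?intr_int.
have : (`|denq x| %| d * `|numq x|)%N.
  have -> : (d * `|numq x| = `|(z * denq x)%R|)%N.
    have -> : (d * `|numq x| = `|(d%:Z * numq x)%R|)%N by rewrite abszM.
    congr absz; apply: (@intr_inj rat); rewrite !intrM numqE -e -pmulrn; ring.
  by rewrite abszM dvdn_mull.
by rewrite Gauss_dvdl // coprime_sym coprime_num_den.
Qed.

Lemma common_denom_dvdn m (q : 'I_m -> rat) d :
  (common_denom q %| d)%N = [forall j, d%:R * q j \is a Num.int].
Proof.
apply/dvdn_biglcmP/forallP => h j; first by rewrite -denq_dvdn h.
by rewrite denq_dvdn.
Qed.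

Lemma heightE (R : realType) m (q : 'I_m -> rat) (d B : nat) :
  common_denom q = d -> (d <= B)%N -> (forall j, `|d%:R * q j| <= B%:R) ->
  (B = d \/ exists j, `|d%:R * q j| = B%:R) -> height R q = ln B%:R.
Proof.
move=> e dB qB at_; rewrite /height e.
rewrite (_ : \big[_/_]_(_ < _) _ = B%:R) ?ratr_nat //.
apply/le_anti/andP; split.
  by apply: bigmax_le => [|j _]; rewrite ?ler_nat.
case: at_ => [->|[j <-]]; first exact: bigmax_ge_id.
exact: (le_bigmax _ (fun j => `|d%:R * q j|)).
Qed.

(** By Bezout, 1 / [denq x] is an integral combination of 1 and [x], and likewise for [y]. So a
    multiplier clearing [x], [y] and [x * y] is divisible by the product of the denominators. *)
Lemma segre_common_denom m (t : 'I_m -> rat) (x y : rat) i j k :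
  t i = x -> t j = y -> t k = x * y ->
  (forall l, (`|denq x| * `|denq y|)%:R * t l \is a Num.int) ->
  common_denom t = (`|denq x| * `|denq y|)%N.
Proof.
move=> ei ej ek h; apply/eqP; rewrite eqn_dvd; apply/andP; split.
  by rewrite common_denom_dvdn; apply/forallP.
have := dvdnn (common_denom t); rewrite {1}common_denom_dvdn => /forallP ht.
have [a ia [b ib e1]] := numq_bezout x.
have [c ic [d id e2]] := numq_bezout y.
have hx := ht i; have hy := ht j; have hxy := ht k.
rewrite ei in hx; rewrite ej in hy; rewrite ek in hxy.
set L : rat := (common_denom t)%:R in hx hy hxy.
have iL : L \is a Num.int by rewrite natr_int.
have /intrP[z ez] : L * (a * x + b) * (c * y + d) \is a Num.int.
  have -> : L * (a * x + b) * (c * y + d) =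
     a * c * (L * (x * y)) + a * d * (L * x) + b * c * (L * y) + b * d * L by ring.
  by repeat (first [assumption | apply: rpredD | apply: rpredM]).
apply/dvdnP; exists `|z|%N; apply/eqP; rewrite -(eqr_nat rat) !natrM !natr_absz.
rewrite !intr_norm -ez -!normrM; apply/eqP; rewrite -[LHS]ger0_norm ?ler0n //.
congr `|_|; transitivity (L * (a * (numq x)%:~R + b * (denq x)%:~R)
                             * (c * (numq y)%:~R + d * (denq y)%:~R)).
  by rewrite e1 e2 !mulr1.
by rewrite !numqE; ring.
Qed.

(** The unscaled entries fix the common denominator, the entries scaled by [C] carry the maximum.
    The entry [C] itself is replaced, when [C] is 1, by the denominator that the height already
    includes in its maximum. *)
Lemma height_segre (R : realType) m (t : 'I_m -> rat) (x y : rat) (C : nat) :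
  (0 < C)%N -> (exists i, t i = x) -> (exists i, t i = y) -> (exists i, t i = x * y) ->
  (forall l, exists2 c, (c <= C)%N & exists2 z, z \in [:: 1; x; y; x * y] & t l = c%:R * z) ->
  (C = 1%N \/ exists l, t l = C%:R) ->
  (forall z, z \in [:: x; y; x * y] -> exists l, t l = C%:R * z) ->
  height R t = ln (C * (ht x * ht y))%:R.
Proof.
move=> C0 [i ei] [j ej] [k ek] tC t1 tx.
pose q : rat := (`|denq x| * `|denq y|)%:R.
have q0 : 0 <= q by rewrite ler0n.
have qE : q = `|(denq x)%:~R| * `|(denq y)%:~R|.
  by rewrite /q natrM !natr_absz !intr_norm.
have qxE : `|q * x| = `|(numq x)%:~R| * `|(denq y)%:~R|.
  by rewrite normrM (ger0_norm q0) qE numqE normrM; ring.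
have qyE : `|q * y| = `|(denq x)%:~R| * `|(numq y)%:~R|.
  by rewrite normrM (ger0_norm q0) qE numqE normrM; ring.
have qxyE : `|q * (x * y)| = `|(numq x)%:~R| * `|(numq y)%:~R|.
  by rewrite !normrM (ger0_norm q0) qE !numqE !normrM; ring.
have qz z : z \in [:: 1; x; y; x * y] ->
    q * z \is a Num.int /\ `|q * z| <= (ht x * ht y)%:R.
  rewrite natrM !htE !inE => /or4P[] /eqP->; split.
  - by rewrite mulr1 natr_int.
  - by rewrite mulr1 ger0_norm // qE ler_pM // le_max lexx orbT.
  - rewrite /q natrM mulrAC [in X in X * _]mulrC natr_absz.
    by rewrite gtr0_norm ?denq_gt0 // -numqE rpredM ?intr_int ?natr_int.
  - by rewrite qxE ler_pM // le_max lexx ?orbT.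
  - rewrite /q natrM -mulrA [in X in _ * X]mulrC [in X in _ * X]natr_absz.
    by rewrite gtr0_norm ?denq_gt0 // -numqE rpredM ?intr_int ?natr_int.
  - by rewrite qyE ler_pM // le_max lexx ?orbT.
  - rewrite /q natrM !natr_absz !gtr0_norm ?denq_gt0 //.
    have -> : (denq x)%:~R * (denq y)%:~R * (x * y)
            = (numq x)%:~R * (numq y)%:~R :> rat by rewrite !numqE; ring.
    by rewrite rpredM ?intr_int.
  - by rewrite qxyE ler_pM // le_max lexx ?orbT.
have qtE l : q * t l \is a Num.int /\ `|q * t l| <= (C * (ht x * ht y))%:R.
  have [c cC [z hz ->]] := tC l; have [iz bz] := qz z hz.
  rewrite mulrCA; split; first by rewrite rpredM ?natr_int.
  by rewrite normrM natrM ler_pM // ger0_norm ?ler_nat ?ler0n.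
apply: (@heightE _ _ _ (`|denq x| * `|denq y|)).
- by apply: (segre_common_denom ei ej ek) => l; case: (qtE l).
- rewrite -[leqLHS]mul1n leq_mul //.
  by rewrite leq_mul // /ht leq_max leqnn orbT.
- by move=> l; case: (qtE l).
have CE z : `|q * z| = (ht x * ht y)%:R -> forall l, t l = C%:R * z ->
    `|q * t l| = (C * (ht x * ht y))%:R.
  by move=> e l ->; rewrite mulrCA normrM e [RHS]natrM ger0_norm ?ler0n.
have : exists2 z, z \in [:: 1; x; y; x * y] & `|q * z| = (ht x * ht y)%:R.
  rewrite natrM !htE.
  have [_|_] := leP `|(numq x)%:~R : rat| _; have [_|_] := leP `|(numq y)%:~R : rat| _.
  - by exists 1; rewrite ?inE ?eqxx // mulr1 ger0_norm.
  - by exists y; rewrite ?inE ?eqxx ?orbT.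
  - by exists x; rewrite ?inE ?eqxx ?orbT.
  - by exists (x * y); rewrite ?inE ?eqxx ?orbT.
case=> z; rewrite inE => /orP[/eqP->|hz] e; last first.
  by right; have [l el] := tx z hz; exists l; apply: CE e _ el.
case: t1 => [C1|[l el]]; last by right; exists l; apply: CE e _ _; rewrite mulr1.
left; apply/eqP; rewrite C1 mul1n -(eqr_nat rat) -e mulr1 ger0_norm //.
Qed.

Lemma height_pair (R : realType) (x y : rat) :
  height R (fun i : 'I_3 => nth 0 [:: x; y; x * y] i) = ln (ht x * ht y)%:R.
Proof.
rewrite -[in RHS](mul1n (ht x * ht y)%N); apply: height_segre => //.
- by exists (inord 0); rewrite inordK.
- by exists (inord 1); rewrite inordK.
- by exists (inord 2); rewrite inordK.
- move=> l; exists 1%N => //; exists (nth 0 [:: x; y; x * y] l); rewrite ?mul1r //.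
  by rewrite inE mem_nth ?orbT //; exact: (ltn_ord l).
- by left.
- move=> z; rewrite -index_mem => hi; rewrite mul1r; exists (Ordinal hi).
  by rewrite nth_index -?index_mem.
Qed.

(** In the scaled entries alone [C] could cancel against denominators; the unscaled ones prevent
    this. A constant factor can thus be put into a height comparison. *)
Lemma height_pair_scaled (R : realType) (x y : rat) (C : nat) : (0 < C)%N ->
  height R (fun i : 'I_7 => nth 0
     [:: x; y; x * y; C%:R; C%:R * x; C%:R * y; C%:R * (x * y)] i)
  = ln (C * (ht x * ht y))%:R.
Proof.
move=> C0; apply: height_segre => //.
- by exists (inord 0); rewrite inordK.
- by exists (inord 1); rewrite inordK.
- by exists (inord 2); rewrite inordK.
- case=> [[|[|[|[|[|[|[|]]]]]]] //= _].
  + by exists 1%N => //; exists x; rewrite ?mul1r // !inE eqxx ?orbT.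
  + by exists 1%N => //; exists y; rewrite ?mul1r // !inE eqxx ?orbT.
  + by exists 1%N => //; exists (x * y); rewrite ?mul1r // !inE eqxx ?orbT.
  + by exists C => //; exists 1; rewrite ?mulr1 // !inE eqxx ?orbT.
  + by exists C => //; exists x => //; rewrite !inE eqxx ?orbT.
  + by exists C => //; exists y => //; rewrite !inE eqxx ?orbT.
  + by exists C => //; exists (x * y) => //; rewrite !inE eqxx ?orbT.
- by right; exists (inord 3); rewrite inordK.
- move=> z; rewrite !inE => /or3P[] /eqP ->.
  + by exists (inord 4); rewrite inordK.
  + by exists (inord 5); rewrite inordK.
  + by exists (inord 6); rewrite inordK.
Qed.

(** * Heights and the group law *)

Lemma int_of_sqr_int (x : rat) : x ^+ 2 \is a Num.int -> x \is a Num.int.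
Proof.
move=> /intrP[z e].
have h : (`|numq x| ^ 2 = `|z| * `|denq x| ^ 2)%N.
  rewrite -!abszX -abszM; congr absz; apply: (@intr_inj rat).
  by rewrite intrM !expr2 !intrM numqE -e; ring.
rewrite -[x]mul1r -(denq_dvdn x 1).
have : (`|denq x| %| `|numq x| ^ 2)%N by rewrite h -mulnn mulnA dvdn_mull.
by rewrite -[(_ ^ 2)%N]muln1 Gauss_dvdr // coprime_pexpr // coprime_sym coprime_num_den.
Qed.

(** With u = a/b in lowest terms, v b^2 is a rational whose square b^4 + 8 a^4 is an integer. *)
Lemma point_int (p : point) : exists2 r : int,
  p.2 = r%:~R / (denq p.1)%:~R ^+ 2 & r ^+ 2 = denq p.1 ^+ 4 + 8 * numq p.1 ^+ 4.
Proof.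
have b0 := denqr_neq0 p.1; have e := quartic_eq p; have ea := numqE p.1.
set a := numq p.1 in ea *; set b := denq p.1 in b0 ea *.
have e2 : (p.2 * b%:~R ^+ 2) ^+ 2 = (b ^+ 4 + 8 * a ^+ 4)%:~R.
  by rewrite intrD intrM ![(_ ^+ 4)%:~R]rmorphXn /= ea; ring: e.
have /intrP[r er] : p.2 * b%:~R ^+ 2 \is a Num.int.
  by apply: int_of_sqr_int; rewrite e2 intr_int.
exists r; first by rewrite -er mulfK // expf_neq0.
by apply: (@intr_inj rat); rewrite -e2 er rmorphXn.
Qed.

Definition pht (p : point) : nat := ht p.1.

Lemma htN x : ht (- x) = ht x.
Proof. by rewrite /ht numqN denqN abszN. Qed.

Lemma pht_sqr (p q : point) : p.1 ^+ 2 = q.1 ^+ 2 -> pht p = pht q.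
Proof.
by move/eqP; rewrite eqf_sqr /pht => /orP[] /eqP -> //; rewrite htN.
Qed.

Lemma pht_tors p (t : bool) : pht (p + tors *+ t) = pht p.
Proof. exact/pht_sqr/(sqr_fst_tors p false t). Qed.

Lemma pht_bounds (p : point) (h := (pht p)%:R : rat) (r : int) :
  r ^+ 2 = denq p.1 ^+ 4 + 8 * numq p.1 ^+ 4 ->
  [/\ `|(numq p.1)%:~R| <= h, `|(denq p.1)%:~R| <= h & `|r%:~R| <= 3 * h ^+ 2].
Proof.
move=> er.
have h0 : 0 <= h by rewrite ler0n.
have ha : `|(numq p.1)%:~R| <= h by rewrite /h htE le_max lexx.
have hb : `|(denq p.1)%:~R| <= h by rewrite /h htE le_max lexx orbT.
split=> //; rewrite -(@ler_pXn2r _ 2) ?nnegrE ?normr_ge0 ?mulr_ge0 ?exprn_ge0 //.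
have -> : `|r%:~R| ^+ 2 = `|(denq p.1)%:~R| ^+ 4 + 8 * `|(numq p.1)%:~R| ^+ 4 :> rat.
  by rewrite -!normrX !ger0_norm ?exprn_even_ge0 // -!rmorphXn er /= intrD intrM.
have -> : (3 * h ^+ 2) ^+ 2 = h ^+ 4 + 8 * h ^+ 4 by ring.
by rewrite lerD ?ler_pM2l // lerXn2r ?nnegrE.
Qed.

(** The numerator u1^2 v2^2 - u2^2 v1^2 is (u1^2 - u2^2)(1 - 8 u1^2 u2^2), so one power of the
    denominator cancels. Hence a single common multiplier clears both coordinates and their product,
    as [segre_bound] requires. *)
Lemma sum_diff_mul (F : fieldType) (p q : F * F) :
  add_den p q != 0 ->
  p.2 ^+ 2 = 1 + 8 * p.1 ^+ 4 -> q.2 ^+ 2 = 1 + 8 * q.1 ^+ 4 ->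
  (add_coords p q).1 * (add_coords p (- q.1, q.2)).1 * add_den p q
  = p.1 ^+ 2 - q.1 ^+ 2.
Proof.
case: p q => [u1 v1] [u2 v2]; rewrite /add_coords /add_den /= sqrrN => D h1 h2.
by field: h1 h2.
Qed.

(** [segre_bound] applies to the first coordinates of the sum and the difference, with [D] the
    denominator of the addition law made integral: all four products are integers quadratic in the
    height of each point. *)
Lemma pht_parallelogram (p q : point) :
  (pht (p + q)%R * pht (p - q)%R <= 9 * (pht p ^ 2 * pht q ^ 2))%N.
Proof.
have [r1 ev1 er1] := point_int p; have [r2 ev2 er2] := point_int q.
have [] := pht_bounds er1; have [] := pht_bounds er2.
have D0 := add_den_neq0 p q.
have b10 := denqr_neq0 p.1; have b20 := denqr_neq0 q.1.
have xy := sum_diff_mul D0 (quartic_eq p) (quartic_eq q).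
have ea1 := numqE p.1; have ea2 := numqE q.1.
pose D : rat := (denq p.1)%:~R ^+ 2 * (denq q.1)%:~R ^+ 2 * add_den p q.
have eD : D = (denq p.1)%:~R ^+ 2 * (denq q.1)%:~R ^+ 2
              - 8 * (numq p.1)%:~R ^+ 2 * (numq q.1)%:~R ^+ 2.
  by rewrite ea1 ea2 /D /add_den; ring.
have xD : (p + q).1 * D = (numq p.1)%:~R * (denq p.1)%:~R * r2%:~R
                        + (numq q.1)%:~R * (denq q.1)%:~R * r1%:~R.
  have e1 : r1%:~R = p.2 * (denq p.1)%:~R ^+ 2 by rewrite ev1 divfK ?expf_neq0.
  have e2 : r2%:~R = q.2 * (denq q.1)%:~R ^+ 2 by rewrite ev2 divfK ?expf_neq0.
  rewrite ea1 ea2 e1 e2 pointDE /= /D [_ * add_den _ _]mulrC mulrA divfK //; ring.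
have yD : (p - q).1 * D = (numq p.1)%:~R * (denq p.1)%:~R * r2%:~R
                        - (numq q.1)%:~R * (denq q.1)%:~R * r1%:~R.
  have e1 : r1%:~R = p.2 * (denq p.1)%:~R ^+ 2 by rewrite ev1 divfK ?expf_neq0.
  have e2 : r2%:~R = q.2 * (denq q.1)%:~R ^+ 2 by rewrite ev2 divfK ?expf_neq0.
  have -> : D = (denq p.1)%:~R ^+ 2 * (denq q.1)%:~R ^+ 2 * add_den p (- q).
    by rewrite /D /add_den pointNE /= sqrrN.
  rewrite ea1 ea2 e1 e2 pointDE /= [_ * add_den _ _]mulrC mulrA divfK ?add_den_neq0 //.
  by ring.
have xyD : (p + q).1 * (p - q).1 * D = (numq p.1)%:~R ^+ 2 * (denq q.1)%:~R ^+ 2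
                        - (numq q.1)%:~R ^+ 2 * (denq p.1)%:~R ^+ 2.
  by rewrite /D [_ * add_den _ _]mulrC mulrA xy ea1 ea2; ring.
set h1 := (pht p)%:R; set h2 := (pht q)%:R.
move: eD xD yD xyD.
set a1 : rat := (numq p.1)%:~R; set b1 : rat := (denq p.1)%:~R.
set a2 : rat := (numq q.1)%:~R; set b2 : rat := (denq q.1)%:~R.
move=> eD xD yD xyD ha2 hb2 hr2 ha1 hb1 hr1.
have h10 : 0 <= h1 by rewrite ler0n.
have h20 : 0 <= h2 by rewrite ler0n.
have BE : (9 * (pht p ^ 2 * pht q ^ 2))%:R = 9 * (h1 ^+ 2 * h2 ^+ 2) :> rat.
  by rewrite -!mulnn !natrM -!expr2.
have H0 : 0 <= h1 ^+ 2 * h2 ^+ 2 by rewrite mulr_ge0 ?exprn_ge0.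
have ib c : `|c| <= h1 -> c ^+ 2 <= h1 ^+ 2.
  by move=> hc; rewrite -[c ^+ 2]ger0_norm ?sqr_ge0 // normrX lerXn2r ?nnegrE.
have ib2 c : `|c| <= h2 -> c ^+ 2 <= h2 ^+ 2.
  by move=> hc; rewrite -[c ^+ 2]ger0_norm ?sqr_ge0 // normrX lerXn2r ?nnegrE.
have mulS c d : `|c| <= h1 -> `|d| <= h2 -> 0 <= c ^+ 2 * d ^+ 2 <= h1 ^+ 2 * h2 ^+ 2.
  by move=> hc hd; rewrite mulr_ge0 ?sqr_ge0 //= ler_pM ?sqr_ge0 ?ib ?ib2.
have Ab : `|a1 * b1 * r2%:~R| <= 3 * (h1 ^+ 2 * h2 ^+ 2).
  rewrite mulrCA !normrM ler_pM ?mulr_ge0 // expr2 ler_pM //.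
have Bb : `|a2 * b2 * r1%:~R| <= 3 * (h1 ^+ 2 * h2 ^+ 2).
  rewrite [h1 ^+ 2 * _]mulrC mulrCA !normrM ler_pM ?mulr_ge0 // expr2 ler_pM //.
apply: (@segre_bound _ _ D).
- by rewrite !mulf_neq0 ?expf_neq0.
- rewrite eD; do ?[apply: rpredB | apply: rpredM | apply: rpredX];
    by rewrite ?intr_int ?natr_int.
- by rewrite xD; do ?[apply: rpredD | apply: rpredM]; rewrite ?intr_int.
- by rewrite yD; do ?[apply: rpredB | apply: rpredM]; rewrite ?intr_int.
- rewrite xyD; do ?[apply: rpredB | apply: rpredM | apply: rpredX];
    by rewrite ?intr_int.
- rewrite BE eD -!mulrA ler_norml.
  have := mulS _ _ hb1 hb2; have := mulS _ _ ha1 ha2; lra.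
- by rewrite BE xD (le_trans (ler_normD _ _)) //; lra.
- by rewrite BE yD (le_trans (ler_normB _ _)) //; lra.
- rewrite BE xyD ler_norml [a2 ^+ 2 * _]mulrC.
  have := mulS _ _ ha1 hb2; have := mulS _ _ hb1 ha2; lra.
Qed.

Lemma dup_fst (p : point) : (p + p).1 = 2 * p.1 * p.2 / (1 - 8 * p.1 ^+ 4).
Proof.
by rewrite pointDE /= /add_den; congr (_ / _); ring.
Qed.

Lemma add_den_diag (F : fieldType) (x : F) :
  add_den (x, 0) (x, 0) = 1 - 8 * x ^+ 4.
Proof. by rewrite /add_den /=; ring. Qed.

Lemma dup_den_neq0 (x : rat) : 1 - 8 * x ^+ 4 != 0.
Proof. by rewrite -add_den_diag add_den_neq0. Qed.

Lemma absz_quartic (a b r : int) : r ^+ 2 = b ^+ 4 + 8 * a ^+ 4 ->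
  (`|b| ^ 4 + 8 * `|a| ^ 4 = `|r| ^ 2)%N.
Proof.
move=> er; apply/eqP; rewrite -eqz_nat PoszD PoszM -!abszX.
by rewrite !gez0_abs ?exprn_even_ge0 // er.
Qed.

(* There is no cancellation in the duplication formula because [b] and [r] are
   odd. *)
Lemma coprime_dup (a b r : int) : coprimez a b -> r ^+ 2 = b ^+ 4 + 8 * a ^+ 4 ->
  coprimez (2 * a * b * r) (b ^+ 4 - 8 * a ^+ 4).
Proof.
move=> co er.
have ob : odd `|b|.
  by apply: quartic_odd (absz_quartic er); rewrite -coprimezE.
have co8 x : `|x|%N = 8 -> coprimez x b.
  by move=> ex; rewrite coprimezE ex -[8]/(2 ^ 3)%N coprime_pexpl // coprime2n.
have cbr : coprimez r b.
  have : coprimez (r ^+ 2) b.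
    rewrite er coprimez_sym /coprimez exprSr gcdzMDl -/(coprimez _ _).
    rewrite coprimez_sym coprimezMl coprimezXl // andbT.
    exact: co8.
  by rewrite expr2 coprimezMl => /andP[].
have odr : coprimez r 2.
  rewrite coprimez_sym coprimezE coprime2n.
  have : odd `|r ^+ 2|%N.
    rewrite er; have : odd `|b ^+ 4|%N by rewrite abszX oddX ob orbT.
    lia.
  by rewrite abszX oddX.
rewrite !coprimezMl -!andbA; apply/and4P; split.
- rewrite coprimezE coprime2n; have : odd `|b ^+ 4|%N by rewrite abszX oddX ob orbT.
  lia.
- rewrite /coprimez (_ : _ - _ = (- 8 * a ^+ 3) * a + b ^+ 4); last by ring.
  by rewrite gcdzMDl -/(coprimez _ _) coprimez_sym coprimezXl // coprimez_sym.
- rewrite /coprimez (_ : _ - _ = b ^+ 3 * b + (- 8 * a ^+ 4)); last by ring.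
  rewrite gcdzMDl -/(coprimez _ _) coprimez_sym coprimezMl coprimezXl // andbT.
  exact: co8.
- rewrite /coprimez (_ : _ - _ = (- r) * r + 2 * b ^+ 4); last first.
    by rewrite mulNr -expr2 er; ring.
  rewrite gcdzMDl -/(coprimez _ _) coprimez_sym coprimezMl coprimez_sym odr /=.
  by rewrite coprimezXl // coprimez_sym.
Qed.

(** By [coprime_dup] the duplication formula is in lowest terms, so its numerator 2abr and
    denominator b^4 - 8a^4 are bounded by the height of the double. Together they bound r^2 = b^4 +
    8a^4, which dominates both fourth powers. *)
Lemma pht_dup p : (pht p ^ 4 <= 2 * pht (p + p)%R)%N.
Proof.
have [r er1 er] := point_int p.
have b0 := denqr_neq0 p.1; have ea := numqE p.1.
have co : coprimez (numq p.1) (denq p.1) by rewrite coprimezE coprime_num_den.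
set a := numq p.1 in er co ea *; set b := denq p.1 in er1 er b0 co ea *.
have cod := coprime_dup co er; rewrite coprimezE in cod.
have dE : (p + p).1 = (2 * a * b * r)%:~R / (b ^+ 4 - 8 * a ^+ 4)%:~R.
  have -> : (b ^+ 4 - 8 * a ^+ 4)%:~R = b%:~R ^+ 4 * (1 - 8 * p.1 ^+ 4) :> rat.
    rewrite intrB intrM !(rmorphXn (intr : int -> rat)) /= ea; ring.
  rewrite dup_fst !intrM er1 ea; field.
  by rewrite b0 dup_den_neq0.
have d0 : b ^+ 4 - 8 * a ^+ 4 != 0.
  rewrite -(intr_eq0 rat) (_ : _%:~R = b%:~R ^+ 4 * (1 - 8 * p.1 ^+ 4)).
    exact: mulf_neq0 (expf_neq0 _ b0) (dup_den_neq0 _).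
  rewrite intrB intrM !(rmorphXn (intr : int -> rat)) /= ea; ring.
set M := pht (p + p).
have Mn : `|2 * a * b * r| <= M%:Z.
  rewrite -abszE lez_nat /M /pht /ht dE coprimeq_num // leq_max.
  rewrite [X in (_ <= X)%N || _]abszM (_ : `|Num.sg _|%N = 1%N).
    by rewrite mul1n leqnn.
  by move: d0; case: sgrP.
have Md : `|b ^+ 4 - 8 * a ^+ 4| <= M%:Z.
  rewrite -abszE lez_nat /M /pht /ht dE coprimeq_den // (negPf d0) leq_max.
  by rewrite /= leqnn orbT.
have M0 : 0 <= M%:Z by [].
have sqM (x : int) : `|x| <= M%:Z -> x ^+ 2 <= M%:Z ^+ 2.
  by move=> hx; rewrite -[x ^+ 2]ger0_norm ?sqr_ge0 // normrX lerXn2r ?nnegrE.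
have rM : `|r| ^+ 2 <= 2 * M%:Z.
  rewrite -(@ler_pXn2r _ 2) ?nnegrE ?mulr_ge0 ?exprn_ge0 //.
  rewrite -normrX ger0_norm ?sqr_ge0 //.
  have := sqM _ Mn; have := sqM _ Md; rewrite exprMn er.
  have -> : (2 * a * b) ^+ 2 = 4 * (a ^+ 2 * b ^+ 2) by ring.
  have -> : a ^+ 4 = (a ^+ 2) ^+ 2 by rewrite -exprM.
  have -> : b ^+ 4 = (b ^+ 2) ^+ 2 by rewrite -exprM.
  move: (sqr_ge0 a) (sqr_ge0 b); move: (a ^+ 2) (b ^+ 2) (M%:Z) => A B m A0 B0 h1 h2.
  (* With A = a^2 and B = b^2, r^4 is (B^2 - 8A^2)^2 + 32 A^2 B^2, and (2abr)^2 - 16 A^2 B^2 is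
     4AB((B - 2A)^2 + (2A)^2). *)
  have := mulr_ge0 (mulr_ge0 A0 B0) (addr_ge0 (sqr_ge0 (B - 2 * A)) (sqr_ge0 (2 * A))).
  have := sqr_ge0 (A * B); clear -h1 h2; move: h1 h2; lra.
have ler x : (`|x|%:Z ^+ 4 <= r ^+ 2) -> (`|x| ^ 4 <= 2 * M)%N.
  move=> h; rewrite -lez_nat PoszM; apply: le_trans rM.
  by rewrite -normrX ger0_norm ?sqr_ge0.
rewrite {1}/pht /ht /maxn; case: ifP => _; apply: ler; rewrite -normrX er.
  rewrite ger0_norm ?exprn_even_ge0 //; have := @exprn_even_ge0 _ 4 a isT; lia.
rewrite ger0_norm ?exprn_even_ge0 //.
have := @exprn_even_ge0 _ 4 b isT; have := @exprn_even_ge0 _ 4 a isT.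
rewrite -/a; lia.
Qed.

(** * The group has rank one *)

Lemma sqr_dup_fst (F : fieldType) (a b k l t : F) :
  k != 0 -> k ^+ 4 - 8 * l ^+ 4 != 0 ->
  a = 2 * t * k * l -> b ^+ 2 = (k ^+ 4 - 8 * l ^+ 4) ^+ 2 ->
  (a / b) ^+ 2 =
  (2 * (l / k) * (t / k ^+ 2) / (1 - 8 * (l / k) ^+ 4)) ^+ 2.
Proof.
move=> k0 D0 -> eb; rewrite expr_div_n eb.
have D1 : 1 - 8 * (l / k) ^+ 4 != 0.
  apply: contraNneq D0 => /(congr1 ( *%R (k ^+ 4))); rewrite mulr0 => <-.
  by apply/eqP; field.
by field; rewrite k0 D0.
Qed.

Lemma sqr_addr1_neq0 (F : numDomainType) (v w : F) :
  0 < v -> v + 1 = w ^+ 2 -> w != 0.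
Proof. by move=> v0 ew; rewrite -sqrf_eq0 -ew gt_eqF // addr_gt0. Qed.

(** These are the two outcomes of [quartic_descent], since v + 1 = (r + b^2) / b^2. Positivity of v
    identifies [r] with its absolute value there. *)
Lemma half_or_sqr (p : point) : 0 < p.2 ->
  (exists q s t, p = (if s then - (q + q) else q + q) + tors *+ nat_of_bool t)
  \/ (exists w, p.2 + 1 = w ^+ 2).
Proof.
move=> v0.
have [r ev er] := point_int p.
have b0 := denqr_neq0 p.1.
have bg0 : (0 < `|denq p.1|)%N by rewrite absz_gt0 denq_eq0.
have [] := quartic_descent bg0 (coprime_num_den _) (absz_quartic er); last first.
  case=> w ew; right; exists (w%:R / (denq p.1)%:~R).
  rewrite expr_div_n -natrX -ew natrD natrX !natr_absz !intr_norm.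
  rewrite real_normK ?num_real // ev mulrDl divff ?expf_neq0 //.
  congr (_ / _ + _); rewrite ger0_norm //.
  move: v0; rewrite ev pmulr_lgt0; first exact: ltW.
  by rewrite invr_gt0 exprn_even_gt0.
move=> [k [l [t [k0 et eal ebl]]]]; left.
have kr0 : k%:R != 0 :> rat by rewrite pnatr_eq0 -lt0n.
have onq : on_quartic (l%:R / k%:R, t%:R / k%:R ^+ 2).
  apply/eqP => /=; rewrite expr_div_n -[t%:R ^+ 2]natrX et natrD natrM !natrX.
  by field.
have {}ebl : (denq p.1)%:~R ^+ 2 = (k%:R ^+ 4 - 8 * l%:R ^+ 4) ^+ 2 :> rat.
  rewrite -[LHS]real_normK ?num_real // -intr_norm -natr_absz.
  case: ebl => /(congr1 (fun n => n%:R : rat)); rewrite !(natrD, natrM, natrX) => h.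
    by rewrite -h; ring.
  by rewrite -h; ring.
have D0 : k%:R ^+ 4 - 8 * l%:R ^+ 4 != 0 :> rat.
  by rewrite -sqrf_eq0 -ebl sqrf_eq0.
exists (Point onq).
have e : p.1 ^+ 2 = (Point onq + Point onq).1 ^+ 2.
  rewrite dup_fst -(sqr_dup_fst kr0 D0 (erefl _) ebl) expr_div_n.
  rewrite -{1}[p.1]divq_num_den expr_div_n; congr (_ / _).
  rewrite -[LHS]real_normK ?num_real // -intr_norm -natr_absz eal.
  by rewrite !natrM.
have [s [u eu]] := sqr_fst_eq e.
by exists s, u.
Qed.

(* [x = 2 (v + 1) / u^2] is the abscissa on the Weierstrass model
   [y^2 = x^3 - 32 x], and [x] modulo squares is multiplicative on sums of
   points; this is the instance with [(1, 3)], where [2 (v + 1) = 8]. *)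
Lemma alpha_gen (F : fieldType) (u v : F) :
  v ^+ 2 = 1 + 8 * u ^+ 4 -> add_den (u, v) (1, 3) != 0 ->
  8 * (v + 1) * ((add_coords (u, v) (1, 3)).2 + 1) * add_den (u, v) (1, 3) ^+ 2
  = (4 * (8 * u ^+ 3 - 2 * u ^+ 2 + 2 * u + 1 + (2 * u + 1) * v)) ^+ 2.
Proof.
by rewrite /add_coords /add_den /= expr1n mulr1 => h D; field: h.
Qed.

(** By [alpha_gen], 2(v' + 1) is a square for the second coordinate v' of [p + gen]. If v' > 0, then
    v' + 1 is not a square, as 2 is not, and [half_or_sqr] yields a half. Otherwise v' >= -1 and
    v'^2 >= 1 force v' = -1, and [p + gen] is [tors]. *)
Lemma half_add_gen (p : point) w : 0 < p.2 -> p.2 + 1 = w ^+ 2 ->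
  exists q s t, p + gen = (if s then - (q + q) else q + q) + tors *+ nat_of_bool t.
Proof.
move=> v0 ew.
have w0 := sqr_addr1_neq0 v0 ew.
have [S eS] : exists S, 2 * ((p + gen).2 + 1) = S ^+ 2.
  have D0 := add_den_neq0 p gen.
  have := @alpha_gen _ p.1 p.2 (quartic_eq p).
  rewrite -surjective_pairing => /(_ D0).
  set S := 4 * _ => h; exists (S / (2 * w * add_den p gen)).
  rewrite expr_div_n -h ew pointDE; field; exact/andP.
have [vp|vn] := ltP 0 (p + gen).2.
  have [//|[w' ew']] := half_or_sqr vp.
  have w'0 := sqr_addr1_neq0 vp ew'.
  case/eqP: (rat_sqr_neq2 (S / w')).
  by rewrite expr_div_n -eS ew' mulfK // sqrf_eq0.
have v1 : (p + gen).2 = - 1.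
  have h := quartic_eq (p + gen).
  have : 0 <= 2 * ((p + gen).2 + 1) by rewrite eS sqr_ge0.
  have : 0 <= (p + gen).1 ^+ 4 by rewrite exprn_even_ge0.
  move: h vn; move: (p + gen).2 => v; move: (_ ^+ 4) => u4 h vn u0 hv.
  apply/le_anti/andP; split; last lra.
  have : (v - 1) * (v + 1) >= 0.
    rewrite (_ : _ * _ = v ^+ 2 - 1); last by ring.
    by rewrite h; lra.
  rewrite nmulr_rge0; lra.
exists 0, false, true; rewrite !add0r; apply: point_eq => //.
have h := quartic_eq (p + gen); rewrite v1 sqrrN expr1n in h.
have /eqP : 8 * (p + gen).1 ^+ 4 = 0 by apply: (addrI 1); rewrite -h addr0.
by rewrite mulf_eq0 expf_eq0 => /eqP.
Qed.

Lemma zmod_halfB (V : zmodType) (q g t : V) :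
  (q - g) + (q - g) + t + g + g = q + q + t.
Proof.
by rewrite addrACA -opprD -[LHS]addrA [LHS]addrAC subrK.
Qed.

Lemma zmod_halfD (V : zmodType) (q g t : V) :
  (q + g) + (q + g) + t = q + q + t + g + g.
Proof. by rewrite -(zmod_halfB (q + g) g t) !addrK. Qed.

Lemma zmod_half_shift (V : zmodType) (p q g t : V) :
  p + g = q + q + t -> p = (q - g) + (q - g) + t + g.
Proof. by move=> e; apply: (addIr g); rewrite e zmod_halfB. Qed.

Lemma zmod_half_back (V : zmodType) (p q g t : V) :
  p = q + q + t + g -> p = (q + g) + (q + g) + g *~ (-1) + t.
Proof. by move=> ->; rewrite mulrNz mulr1z [RHS]addrAC zmod_halfD addrK. Qed.

Lemma zmod_involution (V : zmodType) (p q t g s : V) :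
  s + s = 0 -> p + s = q + t + g -> p = q + (t + s) + g.
Proof.
by move=> ss e; rewrite -[p]addr0 -ss addrA e addrA [LHS]addrAC.
Qed.

Lemma quartic_snd_neq0 (F : realDomainType) (u v : F) :
  v ^+ 2 = 1 + 8 * u ^+ 4 -> v != 0.
Proof.
move=> h; rewrite -sqrf_eq0 h gt_eqF // ltr_wpDr // mulr_ge0 //.
by rewrite exprn_even_ge0.
Qed.

(** Adding [tors] flips the sign of the second coordinate, which may thus be taken positive; then
    [p] or [p + gen] is a double up to sign and torsion, and the sign is absorbed into the half. *)
Lemma mod2_cover (p : point) : exists q (t c : bool),
  p = q + q + tors *+ t + gen *+ c.
Proof.
have sgn (q : point) (s : bool) : exists q', (if s then - (q + q) else q + q) = q' + q'.
  by case: s; [exists (- q); rewrite opprD | exists q].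
have main (p' : point) : 0 < p'.2 -> exists q (t c : bool),
    p' = q + q + tors *+ t + gen *+ c.
  move=> v0; have [[q [s [t ->]]]|[w ew]] := half_or_sqr v0.
    by have [q' ->] := sgn q s; exists q', t, false; rewrite addr0.
  have [q [s [t e]]] := half_add_gen v0 ew.
  have [q' e'] := sgn q s; rewrite e' in e.
  exists (q' - gen), t, true; exact: (@zmod_half_shift point _ _ gen _ e).
have vn0 := quartic_snd_neq0 (quartic_eq p).
have [vp|vn] := ltP 0 p.2; first exact: main.
have [q [t [c e]]] : exists q (t c : bool), p + tors = q + q + tors *+ t + gen *+ c.
  by apply: main; rewrite addr_tors /= oppr_gt0 lt_neqAle vn0.
exists q, (t (+) true), c.
by rewrite -tors_addb; exact: zmod_involution tors2 e.
Qed.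

(** The inequalities combine to x^8 <= 4ab <= 36 x^2, whereas x^6 >= 64. *)
Lemma pow4_descent (x a b : nat) : (1 < x)%N ->
  (x ^ 4 <= 2 * a)%N -> (x ^ 4 <= 2 * b)%N -> ~ (a * b <= 9 * x ^ 2)%N.
Proof.
move=> x1 ha hb hab; have h := leq_mul ha hb.
have : (x ^ 2 * x ^ 6 <= x ^ 2 * 36)%N.
  rewrite -expnD -[(2 + 6)%N]/(4 + 4)%N expnD; apply: leq_trans h _.
  have -> : (2 * a * (2 * b) = 4 * (a * b))%N by ring.
  have -> : (x ^ 2 * 36 = 4 * (9 * x ^ 2))%N by ring.
  by rewrite leq_pmul2l.
rewrite leq_pmul2l ?expn_gt0 ?(ltnW x1) // => h3.
have h6 : (2 ^ 6 <= x ^ 6)%N by rewrite leq_exp2r.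
by have := leq_trans h6 h3.
Qed.

(** Descent on the height: height 1 leaves only the first coordinates 0 and ± 1, and otherwise
    [mod2_cover] expresses the point through one of smaller height. *)
Lemma rank_one_int (p : point) : exists (n : int) (t : bool), p = gen *~ n + tors *+ t.
Proof.
have [m] := ubnP (pht p); elim: m p => // m IH p; rewrite ltnS => pm.
have [h1|h1] := leqP (pht p) 1.
  have [u0|u1] : p.1 ^+ 2 = 0 \/ p.1 ^+ 2 = 1.
    move: h1; rewrite /pht /ht geq_max => /andP[hn hd].
    have d1 : denq p.1 = 1 by move: (denq_gt0 p.1); lia.
    have [n [-> hz]] : exists n : int, p.1 = n%:~R /\ (n = 0 \/ n = 1 \/ n = -1).
      exists (numq p.1); split; last lia.
      by rewrite numqE d1 mulr1.
    by case: hz => [->|[->|->]]; [left|right|right].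
  - have [s [t ->]] := @sqr_fst_eq p 0 u0.
    by exists 0, t; rewrite oppr0 if_same mulr0z.
  - have [s [t ->]] := @sqr_fst_eq p gen u1.
    by exists (if s then -1 else 1), t; case: s; rewrite ?mulrNz mulr1z.
have [q [t [c e]]] := mod2_cover p.
have step q' (n : int) (t' : bool) :
    p = q' + q' + gen *~ n + tors *+ t' -> (pht q' < pht p)%N ->
    exists (n : int) (t : bool), p = gen *~ n + tors *+ t.
  move=> e' h; have [|n' [t'' eq']] := IH q'; first exact: leq_trans h pm.
  exists (n' + n' + n), t'; rewrite e' eq' !mulrzDr addrACA tors_addb.
  by case: t'' {eq'} => /=; rewrite mulr0n addr0.
(* When [p = 2 q + t + gen], [p - gen] and [p + gen] are up to torsion the
   doubles of [q] and [q + gen], one of which has smaller height than [p]. *)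
case: c e => e.
  have eq1 : pht (p - gen) = pht (q + q).
    by rewrite e mulr1n addrK pht_tors.
  have eq2 : pht (p + gen) = pht ((q + gen) + (q + gen)).
    by rewrite e mulr1n -zmod_halfD pht_tors.
  have h := pht_parallelogram p gen; rewrite eq1 eq2 in h.
  have [d1 d2] := (pht_dup q, pht_dup (q + gen)).
  have [hq|hq] := ltnP (pht q) (pht p).
    by apply: (step q 1 t) => //; rewrite e mulr1z mulr1n addrAC.
  have [hq'|hq'] := ltnP (pht (q + gen)) (pht p).
    exact: (step (q + gen) (-1) t (@zmod_half_back point _ _ _ _ e)).
  exfalso.
  have g1 : pht gen = 1%N by [].
  have leP4 x : (pht p <= pht x)%N -> (pht p ^ 4 <= pht x ^ 4)%N by rewrite leq_exp2r.
  apply: (pow4_descent h1 (leq_trans (leP4 _ hq') d2) (leq_trans (leP4 _ hq) d1)).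
  by move: h; rewrite g1 exp1n muln1.
(* Here [p] is a double up to torsion. If [q] were at least as high, [pht_dup] would give h^4 <= 2h
   for the height h > 1 of [p]. *)
have eqp : pht p = pht (q + q) by rewrite e addr0 pht_tors.
apply: (step q 0 t); first by rewrite e mulr0z mulr0n !addr0.
rewrite ltnNge; apply/negP => hq.
have hd : (pht p ^ 4 <= 2 * pht p)%N.
  by rewrite [in X in (_ <= X)%N]eqp; apply: leq_trans (pht_dup q); rewrite leq_exp2r.
have : (pht p * pht p ^ 3 <= pht p * 2)%N by rewrite -expnS [leqRHS]mulnC.
rewrite leq_pmul2l ?(ltnW h1) // => h3.
have : (2 ^ 3 <= pht p ^ 3)%N by rewrite leq_exp2r.
by move=> h6; have := leq_trans h6 h3.
Qed.

Definition mulgen (n : nat) : rat := (gen *+ n).1.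

Lemma rank_one (p : point) : exists n, p.1 ^+ 2 = mulgen n ^+ 2.
Proof.
have [n [t ->]] := rank_one_int p; exists `|n|%N.
rewrite (sqr_fst_tors _ false t); case: n => n; first by rewrite -pmulrn.
by rewrite NegzE mulrNz -pmulrn pointNE /= sqrrN.
Qed.

(** * Quasi-quadratic growth *)

Section QuasiQuadratic.
Variables (R : realFieldType) (f : nat -> R) (kappa : R).
Hypothesis kappa_gt0 : 0 < kappa.
Hypothesis f0 : f 0 = 0.
Hypothesis quasi_parallelogram : forall n m, (m <= n)%N ->
  `|f (n + m) + f (n - m) - 2 * f n - 2 * f m| <= kappa.

(** The error [e k] vanishes at 0 and 1 and its second differences are at most [kappa]; summing
    twice bounds it by kappa (k^2 - k) / 2, uniformly in [n]. *)
Lemma quasi_quadratic k n :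
  2 * `|f (k * n) - k%:R ^+ 2 * f n| <= kappa * k%:R ^+ 2.
Proof.
pose e k := f (k * n) - k%:R ^+ 2 * f n.
have second k' : `|e k'.+2 - 2 * e k'.+1 + e k'| <= kappa.
  have := quasi_parallelogram (leq_addl (k' * n) n).
  rewrite addnK (_ : k' * n + n + n = k'.+2 * n)%N; last by rewrite !mulSn; lia.
  rewrite (_ : k' * n + n = k'.+1 * n)%N; last by rewrite mulSn addnC.
  apply: le_trans; rewrite le_eqVlt; apply/orP; left; apply/eqP; congr `|_|.
  rewrite /e -[k'.+2]addn2 -[k'.+1]addn1 !natrD; ring.
have e0 : e 0%N = 0 by rewrite /e mul0n f0 expr0n /=; ring.
have e1 : e 1%N = 0 by rewrite /e mul1n expr1n; ring.
rewrite -/(e k); clearbody e.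
have main j : `|e j.+1 - e j| <= kappa * j%:R /\
                  2 * `|e j| <= kappa * (j%:R ^+ 2 - j%:R).
  elim: j => [|j [IH1 IH2]].
    by rewrite e0 e1 subrr normr0 !mulr0 expr0n /= subrr mulr0.
  split; last first.
    have := ler_normD (e j.+1 - e j) (e j); rewrite subrK => h.
    rewrite -natr1; nra.
  have := ler_normD (e j.+2 - 2 * e j.+1 + e j) (e j.+1 - e j).
  have -> : e j.+2 - 2 * e j.+1 + e j + (e j.+1 - e j) = e j.+2 - e j.+1.
    by ring.
  by have := second j; rewrite -natr1; lra.
have [_ h] := main k; apply: le_trans h _.
by rewrite ler_pM2l // gerBl ler0n.
Qed.

(** [f (K * x)] is close to both K^2 f(x) and x^2 f(K). After division by K^2 each error is at most
    kappa / 2, because [x <= K]. *)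
Lemma quadratic_approx K x : (x <= K)%N -> (0 < K)%N ->
  `|f x - f K / K%:R ^+ 2 * x%:R ^+ 2| <= kappa.
Proof.
move=> xK K0; have Kr : 0 < K%:R ^+ 2 :> R by rewrite exprn_gt0 ?ltr0n.
have h1 := quasi_quadratic K x; have h2 := quasi_quadratic x K.
rewrite mulnC in h2.
rewrite -(ler_pM2l Kr) -[in X in X * `|_|](gtr0_norm Kr) -normrM.
have -> : K%:R ^+ 2 * (f x - f K / K%:R ^+ 2 * x%:R ^+ 2) =
  (f (K * x)%N - x%:R ^+ 2 * f K) - (f (K * x)%N - K%:R ^+ 2 * f x).
  by field; rewrite pnatr_eq0 -lt0n.
have xKr : x%:R ^+ 2 <= K%:R ^+ 2 :> R by rewrite lerXn2r ?nnegrE ?ler0n ?ler_nat.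
have := ler_normB (f (K * x)%N - x%:R ^+ 2 * f K) (f (K * x)%N - K%:R ^+ 2 * f x).
by have := ler_wpM2l (ltW kappa_gt0) xKr; lra.
Qed.

(* As [f 4 >= 3 kappa], the leading coefficient of [f] is at least [kappa / 8]:
   at the arguments [16 n] a gap of 1 between sums of squares contributes at least
   [32 kappa], more than the errors.  The coefficient is read off at one [K]
   beyond all arguments, so that no limit is needed. *)
Hypothesis f4 : 3 * kappa <= f 4.

Lemma quadratic_compare a b c d :
  (a ^ 2 + b ^ 2 <= c ^ 2 + d ^ 2)%N <->
  f (16 * a) + f (16 * b) <= f (16 * c) + f (16 * d) + 4 * kappa.
Proof.
pose K := (4 + 16 * (a + b + c + d))%N.
pose g := f K / K%:R ^+ 2.
have app x : (x <= K)%N -> `|f x - g * x%:R ^+ 2| <= kappa.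
  by move=> xK; exact: quadratic_approx.
have g0 : kappa / 8 <= g.
  have := app 4 (leq_addr _ _); rewrite ler_norml => /andP[_ h].
  by have := f4; lra.
have ha := app (16 * a)%N ltac:(rewrite /K; lia).
have hb := app (16 * b)%N ltac:(rewrite /K; lia).
have hc := app (16 * c)%N ltac:(rewrite /K; lia).
have hd := app (16 * d)%N ltac:(rewrite /K; lia).
move: ha hb hc hd; rewrite !natrM !ler_norml.
move=> /andP[a1 a2] /andP[b1 b2] /andP[c1 c2] /andP[d1 d2].
have k0 := kappa_gt0.
split=> h.
  have : (a%:R ^+ 2 + b%:R ^+ 2 <= c%:R ^+ 2 + d%:R ^+ 2 :> R).
    by rewrite -!natrX -!natrD ler_nat.
  have g1 : 0 <= g by lra.
  by move/(ler_wpM2l g1); lra.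
rewrite leqNgt; apply/negP => lt.
have : (c%:R ^+ 2 + d%:R ^+ 2 + 1 <= a%:R ^+ 2 + b%:R ^+ 2 :> R).
  by rewrite -!natrX -!natrD natr1 ler_nat.
have g1 : 0 <= g by lra.
by move/(ler_wpM2l g1); lra.
Qed.

End QuasiQuadratic.

(** * Height growth along the multiples of the generator *)

Lemma sum_add_diff (V : zmodType) (p q : V) : p + q + (p - q) = p + p.
Proof. by rewrite addrACA subrr addr0. Qed.

Lemma sum_sub_diff (V : zmodType) (p q : V) : p + q - (p - q) = q + q.
Proof. by rewrite opprB [p + q]addrC addrACA subrr addr0. Qed.

(** The upper bound for [p + q] and [p - q], whose sum and difference are the doubles of [p] and
    [q], combines with [pht_dup]; the constant arises as 6^2 = 2 * 2 * 9. *)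
Lemma pht_parallelogram_lower (p q : point) :
  (pht p ^ 2 * pht q ^ 2 <= 6 * (pht (p + q)%R * pht (p - q)%R))%N.
Proof.
have h := pht_parallelogram (p + q) (p - q).
rewrite sum_add_diff sum_sub_diff in h.
rewrite -(@leq_exp2r _ _ 2) // expnMn -!expnM.
apply: leq_trans (leq_mul (pht_dup p) (pht_dup q)) _.
by rewrite mulnACA !expnMn -[(6 ^ 2)%N]/(2 * 2 * 9)%N -[X in (_ <= X)%N]mulnA leq_pmul2l.
Qed.

Definition genht (n : nat) : nat := pht (gen *+ n).

Lemma genht_gt0 n : (0 < genht n)%N.
Proof. exact: ht_gt0. Qed.

Lemma genht_dup n : (genht n ^ 4 <= 2 * genht (n + n))%N.
Proof. rewrite /genht mulrnDr; exact: pht_dup. Qed.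

Lemma genht2 : genht 2 = 7%N.
Proof. by rewrite /genht mulr2n /pht dup_fst; vm_compute. Qed.

(** As 729 is 9^3, this is the growth hypothesis of [quadratic_compare] for [kappa] = ln 9. It
    follows from 7^4 <= 2 * [genht 4]. *)
Lemma genht4 : (729 <= genht 4)%N.
Proof. have := genht_dup 2; rewrite genht2 [(2 + 2)%N](erefl 4%N); lia. Qed.

Lemma genht_parallelogram m n : (m <= n)%N ->
  (genht (n + m) * genht (n - m) <= 9 * (genht n ^ 2 * genht m ^ 2))%N /\
  (genht n ^ 2 * genht m ^ 2 <= 9 * (genht (n + m) * genht (n - m)))%N.
Proof.
move=> mn; rewrite /genht mulrnDr mulrnBr //; split.
  exact: pht_parallelogram.
apply: leq_trans (pht_parallelogram_lower _ _) _.
by rewrite leq_mul2r orbT.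
Qed.

(** This is [quadratic_compare] for the logarithm of [genht] with [kappa] = ln 9; the slack of 4
    [kappa] becomes the factor 9^4. *)
Lemma genht_compare (R : realType) a b c d :
  (a ^ 2 + b ^ 2 <= c ^ 2 + d ^ 2)%N <->
  (genht (16 * a) * genht (16 * b) <=
     9 ^ 4 * (genht (16 * c) * genht (16 * d)))%N.
Proof.
pose f n : R := ln (genht n)%:R.
have h0 := genht_gt0.
have lnM' m n : (0 < m)%N -> (0 < n)%N -> ln (m * n)%:R = ln m%:R + ln n%:R :> R.
  by move=> m0 n0; rewrite natrM lnM ?posrE ?ltr0n.
have lnle m n : (0 < m)%N -> (0 < n)%N -> (m <= n)%N = (ln m%:R <= ln n%:R :> R).
  by move=> m0 n0; rewrite ler_ln ?posrE ?ltr0n // ler_nat.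
have k0 : 0 < ln 9%:R :> R by rewrite ln_gt0 // ltr1n.
have f0 : f 0%N = 0 by rewrite /f /genht mulr0n ln1.
have par n m : (m <= n)%N ->
    `|f (n + m)%N + f (n - m)%N - 2 * f n - 2 * f m| <= ln 9%:R.
  move=> mn.
  have [h1 h3] := genht_parallelogram mn.
  rewrite lnle ?muln_gt0 ?expn_gt0 ?h0 // -!mulnn !lnM' ?muln_gt0 ?h0 // in h1.
  rewrite lnle ?muln_gt0 ?expn_gt0 ?h0 // -!mulnn !lnM' ?muln_gt0 ?h0 // in h3.
  by rewrite ler_norml; rewrite /f; lra.
have f4 : 3 * ln 9%:R <= f 4%N.
  have -> : 3 * ln 9%:R = ln (9 * (9 * 9))%:R :> R by rewrite !lnM' //; ring.
  by rewrite /f -lnle ?genht_gt0 ?genht4.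
have f16 := quadratic_compare k0 f0 par f4 a b c d.
have e x y : ln (genht x * genht y)%:R = f x + f y by exact: lnM' (h0 x) (h0 y).
have e9 : ln (9 ^ 4)%:R = 4 * ln 9%:R :> R by rewrite natrX lnXn ?ltr0n // mulr_natl.
have pos x y : (0 < genht x * genht y)%N by rewrite muln_gt0 !h0.
have pos9 x y : (0 < 9 ^ 4 * (genht x * genht y))%N by rewrite muln_gt0 pos.
have -> := lnle _ _ (pos (16 * a)%N (16 * b)%N) (pos9 (16 * c)%N (16 * d)%N).
have -> := lnM' (9 ^ 4)%N _ isT (pos (16 * c)%N (16 * d)%N).
rewrite !e e9 [4 * _ + _]addrC; exact: f16.
Qed.

(** * Coding natural numbers by points *)

Definition codes (u : rat) (n : nat) : bool := u ^+ 2 == mulgen n ^+ 2.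

Lemma codes_mulgen n : codes (mulgen n) n.
Proof. exact: eqxx. Qed.

Lemma ht_codes u n : codes u n -> ht u = genht n.
Proof.
by rewrite /codes eqf_sqr /genht /pht /mulgen => /orP[] /eqP -> //; rewrite htN.
Qed.

Lemma quartic_codes u : (exists v, v ^+ 2 = 1 + 8 * u ^+ 4) <-> (exists n, codes u n).
Proof.
split=> [[v e]|[n /eqP e]].
  have h : on_quartic (u, v) by apply/eqP.
  by have [n en] := rank_one (Point h); exists n; apply/eqP.
exists (gen *+ n).2; rewrite quartic_eq -/(mulgen n).
by rewrite -[4%N]/(2 * 2)%N !exprM e.
Qed.

Lemma codes_point (p : point) n : codes p.1 n ->
  exists s t : bool, p = (if s then - gen *+ n else gen *+ n) + tors *+ t.
Proof.
move/eqP/sqr_fst_eq => [s [t ->]]; exists s, t.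
by case: s; rewrite ?mulNrn.
Qed.

Lemma torsMn2 (t : bool) m : tors *+ t *+ (2 * m) = 0.
Proof. by rewrite mulrnA mulr2n -mulrnDl tors2 !mul0rn. Qed.

(** The two multiples of [gen] agree up to sign and torsion. Multiplication by 16 kills the torsion
    and heights ignore the sign, so [genht] agrees at [16 * m] and [16 * n], and [genht_compare]
    applies both ways. *)
Lemma codes_inj (R : realType) u m n : codes u m -> codes u n -> m = n.
Proof.
move=> /eqP em /eqP en.
have h : genht (16 * m) = genht (16 * n).
  have [|s [t e]] := @codes_point (gen *+ m) n; first by rewrite /codes -em -en.
  apply: pht_sqr; rewrite mulnC mulrnA e mulrnDl -[16%N]/(2 * 8)%N torsMn2 addr0.
  have -> : (2 * 8 * n = n * (2 * 8))%N by rewrite mulnC.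
  by case: s {e}; rewrite -mulrnA // mulNrn pointNE /= sqrrN.
have le x y : genht (16 * x) = genht (16 * y) -> (x <= y)%N.
  move=> e; rewrite -(@leq_exp2r _ _ 2) //.
  have [_] := genht_compare R x 0 y 0; rewrite exp0n // !addn0; apply.
  by rewrite e leq_pmull // expn_gt0.
by apply/eqP; rewrite eqn_leq !le.
Qed.

(* The points above [u1] and [u2] are determined up to sign and torsion only, so
   this relation cannot tell sums from differences. *)
Definition sum_rel (u1 u2 u3 : rat) : Prop :=
  exists v1 v2 w, [/\ v1 ^+ 2 = 1 + 8 * u1 ^+ 4, v2 ^+ 2 = 1 + 8 * u2 ^+ 4,
    w ^+ 2 = u3 ^+ 2 & w * (1 - 8 * u1 ^+ 2 * u2 ^+ 2) = u1 * v2 + u2 * v1].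

Lemma sum_relP (u1 u2 u3 : rat) :
  sum_rel u1 u2 u3 <->
  exists p q : point, [/\ p.1 = u1, q.1 = u2 & (p + q).1 ^+ 2 = u3 ^+ 2].
Proof.
have D0 : 1 - 8 * u1 ^+ 2 * u2 ^+ 2 != 0 := add_den_neq0 (u1, 0) (u2, 0).
rewrite /sum_rel.
split=> [[v1 [v2 [w [e1 e2 <- e]]]]|[p [q [e1 e2 <-]]]].
  have h1 : on_quartic (u1, v1) by apply/eqP.
  have h2 : on_quartic (u2, v2) by apply/eqP.
  exists (Point h1), (Point h2); split=> //.
  by rewrite pointDE /add_coords /add_den /= -e mulfK.
exists p.2, q.2, (p + q).1; rewrite -e1 -e2 !quartic_eq; split=> //.
by rewrite pointDE /add_coords /add_den /= divfK // e1 e2.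
Qed.


(** With truncated subtraction, [(a - b) + (b - a)] is the distance |a - b|. *)
Lemma mulrn_signs (V : zmodType) (g : V) a b (s1 s2 : bool) : exists s : bool,
  (if s1 then - (g *+ a) else g *+ a) + (if s2 then - (g *+ b) else g *+ b) =
  if s then - (g *+ (if s1 == s2 then a + b else (a - b) + (b - a))%N)
  else g *+ (if s1 == s2 then a + b else (a - b) + (b - a))%N.
Proof.
have sub c d : exists s : bool, g *+ c - g *+ d =
    if s then - (g *+ (c - d + (d - c))%N) else g *+ (c - d + (d - c))%N.
  have [cd|/ltnW cd] := leqP d c.
    by exists false; rewrite -mulrnBr // (eqP cd) addn0.
  by exists true; rewrite (eqP cd) add0n mulrnBr // opprB.
case: s1 s2 => [] [] /=.
- by exists true; rewrite mulrnDr opprD.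
- by have [s e] := sub b a; exists s; rewrite addrC e addnC.
- exact: sub.
- by exists false; rewrite mulrnDr.
Qed.

Lemma sum_fst_sqr n1 n2 (s1 s2 t1 t2 : bool) :
  ((if s1 then - gen *+ n1 else gen *+ n1) + tors *+ t1 +
   ((if s2 then - gen *+ n2 else gen *+ n2) + tors *+ t2)).1 ^+ 2
  = mulgen (if s1 == s2 then n1 + n2 else (n1 - n2) + (n2 - n1))%N ^+ 2.
Proof.
rewrite addrACA tors_addb !mulNrn.
by have [s ->] := mulrn_signs gen n1 n2 s1 s2; rewrite sqr_fst_tors.
Qed.

(** The sign [s] can be prescribed because [tors] also flips the first coordinate and corrects a
    mismatch. *)
Lemma codes_lift u n (s : bool) : codes u n ->
  exists t : bool, ((if s then - gen *+ n else gen *+ n) + tors *+ t).1 = u.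
Proof.
rewrite /codes eqf_sqr => /orP[] /eqP ->; case: s.
- by exists true; rewrite mulr1n addr_tors mulNrn pointNE /= opprK.
- by exists false; rewrite addr0.
- by exists false; rewrite addr0 mulNrn pointNE.
- by exists true; rewrite mulr1n addr_tors.
Qed.

Lemma sum_rel_codes (R : realType) u1 u2 u3 n1 n2 n3 :
  codes u1 n1 -> codes u2 n2 -> codes u3 n3 ->
  sum_rel u1 u2 u3 <-> [\/ n3 = n1 + n2, n1 = n2 + n3 | n2 = n1 + n3]%N.
Proof.
move=> c1 c2 c3; rewrite sum_relP; split.
  move=> [p [q [e1 e2 e3]]].
  have [|s1 [t1 ep]] := @codes_point p n1; first by rewrite e1.
  have [|s2 [t2 eq]] := @codes_point q n2; first by rewrite e2.
  rewrite ep eq sum_fst_sqr in e3.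
  have -> := codes_inj R c3 (introT eqP (esym e3)).
  case: eqP => _; first by constructor 1.
  have [le|/ltnW le] := leqP n1 n2.
    by constructor 3; rewrite (eqP le) add0n subnKC.
  by constructor 2; rewrite (eqP le) addn0 subnKC.
(* Equal signs realize the sum; opposite signs realize the distance, which covers the two other
   alternatives. *)
move=> h; pose s := n3 != (n1 + n2)%N.
have [t1 e1] := codes_lift false c1; have [t2 e2] := codes_lift s c2.
exists (gen *+ n1 + tors *+ t1), ((if s then - gen *+ n2 else gen *+ n2) + tors *+ t2).
split=> //; rewrite (sum_fst_sqr n1 n2 false s t1 t2) (eqP c3); congr (mulgen _ ^+ 2).
rewrite /s; case: (n3 =P (n1 + n2)%N) => [-> //|ne] /=.
by case: h => [//|h|h]; lia.
Qed.

(** Unlike [sum_rel], doubling is unambiguous: both summands are the same point, so their signs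
    agree. *)
Lemma double_codes (R : realType) u u' n n' : codes u n -> codes u' n' ->
  (exists v w, [/\ v ^+ 2 = 1 + 8 * u ^+ 4, w ^+ 2 = u' ^+ 2 &
      w * (1 - 8 * u ^+ 4) = 2 * u * v]) <-> n' = (2 * n)%N.
Proof.
move=> c c'.
have dup (p : point) : p.1 = u -> (p + p).1 ^+ 2 = mulgen (2 * n) ^+ 2.
  move=> e; have [|s [t ->]] := @codes_point p n; first by rewrite e.
  by rewrite sum_fst_sqr eqxx addnn mul2n.
split=> [[v [w [ev ew e]]]|e].
  have h : on_quartic (u, v) by apply/eqP.
  apply: (codes_inj R c'); apply/eqP; rewrite -(dup (Point h)) // -ew.
  by rewrite dup_fst /= -e mulfK // dup_den_neq0.
have [t et] := codes_lift false c; set p := (_ + _) in et.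
exists p.2, (p + p).1; rewrite -et quartic_eq; split=> //.
  by rewrite dup // -e (eqP c').
by rewrite dup_fst divfK // dup_den_neq0.
Qed.

(** * Positive existential definability *)

Lemma eq_height (R : realType) m (q q' : 'I_m -> rat) :
  q =1 q' -> height R q = height R q'.
Proof.
move=> e; rewrite /height (_ : common_denom q = common_denom q').
  by congr (ln (ratr _)); apply: eq_bigr => j _; rewrite e.
by apply: eq_bigr => j _; rewrite e.
Qed.

Section Definability.
Variable R : realType.
Notation L := height_language.
Notation M := (rat_height_structure R).

Definition term_definable (V : Type) (F : (V -> rat) -> rat) : Prop :=
  exists t : term L V, forall e : V -> M, teval e t = F e.

Lemma tdef_var V (v : V) : term_definable (fun e => e v).
Proof. by exists (TVar v). Qed.

Lemma tdef0 V : term_definable (fun _ : V -> rat => 0).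
Proof. by exists (@TConst L V Zero). Qed.

Lemma tdef1 V : term_definable (fun _ : V -> rat => 1).
Proof. by exists (@TConst L V One). Qed.

Lemma tdefD V (F G : (V -> rat) -> rat) :
  term_definable F -> term_definable G -> term_definable (fun e => F e + G e).
Proof.
move=> [t et] [u eu].
exists (@TFun L V Add (fun i : 'I_2 => if i == ord0 then t else u)) => e /=.
by rewrite et eu.
Qed.

Lemma tdefM V (F G : (V -> rat) -> rat) :
  term_definable F -> term_definable G -> term_definable (fun e => F e * G e).
Proof.
move=> [t et] [u eu].
exists (@TFun L V Mul (fun i : 'I_2 => if i == ord0 then t else u)) => e /=.
by rewrite et eu.
Qed.

Lemma tdef_nat V n : term_definable (fun _ : V -> rat => n%:R).
Proof.
elim: n => [|n IH]; first exact: tdef0.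
have [t et] := tdefD IH (tdef1 V).
by exists t => e; rewrite et natr1.
Qed.

Lemma tdefX V (F : (V -> rat) -> rat) n :
  term_definable F -> term_definable (fun e => F e ^+ n).
Proof.
move=> dF; elim: n => [|n IH]; first exact: tdef1.
have [t et] := tdefM dF IH.
by exists t => e; rewrite et exprS.
Qed.

Definition pe_definable (V : Type) (S : (V -> rat) -> Prop) : Prop :=
  exists2 p : formula L V, pos_exist p &
    forall e : V -> M, realization p e <-> S e.

Lemma pe_iff V (S S' : (V -> rat) -> Prop) :
  (forall e, S e <-> S' e) -> pe_definable S -> pe_definable S'.
Proof. by move=> h [p pp ep]; exists p => // e; rewrite ep. Qed.

Lemma pe_eq V (F G : (V -> rat) -> rat) :
  term_definable F -> term_definable G -> pe_definable (fun e => F e = G e).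
Proof.
move=> [t et] [u eu].
exists (@FRel L V HEq (fun i : 'I_2 => if i == ord0 then t else u)) => // e /=.
by rewrite et eu.
Qed.

Lemma pe_and V (S T : (V -> rat) -> Prop) :
  pe_definable S -> pe_definable T -> pe_definable (fun e => S e /\ T e).
Proof.
move=> [p pp ep] [q pq eq]; exists (FAnd p q) => //= e.
by rewrite ep eq.
Qed.

Lemma pe_ex V (S : (V -> rat) -> rat -> Prop) :
  pe_definable (fun e : option V -> rat => S (fun v => e (Some v)) (e None)) ->
  pe_definable (fun e => exists a, S e a).
Proof.
move=> [p pp ep]; exists (FEx p) => //= e.
by split=> -[a ha]; exists a; apply/(ep (extend e a)).
Qed.

Definition terms_definable (V : Type) (Fs : seq ((V -> rat) -> rat)) : Prop :=
  exists ts : seq (term L V), size ts = size Fs /\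
    forall (e : V -> M) i,
      nth 0 [seq teval e t | t <- ts] i = nth 0 [seq F e | F <- Fs] i.

Lemma tsdef_nil V : terms_definable (Nil ((V -> rat) -> rat)).
Proof. by exists [::]. Qed.

Lemma tsdef_cons V (F : (V -> rat) -> rat) Fs :
  term_definable F -> terms_definable Fs -> terms_definable (F :: Fs).
Proof.
move=> [t et] [ts [sz ets]]; exists (t :: ts); split=> /=; first by rewrite sz.
by move=> e [|i] /=.
Qed.

Lemma pe_height_le V m n (Fs Gs : seq ((V -> rat) -> rat)) :
  size Fs = m.+1 -> size Gs = n.+1 -> terms_definable Fs -> terms_definable Gs ->
  pe_definable (fun e =>
    height R (fun i : 'I_m.+1 => nth 0 [seq F e | F <- Fs] i)
    <= height R (fun j : 'I_n.+1 => nth 0 [seq G e | G <- Gs] j)).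
Proof.
move=> sF sG [ts [st et]] [us [su eu]].
exists (@FRel L V (HeightLe m n)
  (fun i : 'I_(m.+1 + n.+1) => nth (@TConst L V Zero) (ts ++ us) i)) => // e.
rewrite /= (@eq_height _ _ _ (fun i : 'I_m.+1 => nth 0 [seq F e | F <- Fs] i)).
  rewrite (@eq_height _ _ (fun i : 'I_n.+1 => _)
    (fun j : 'I_n.+1 => nth 0 [seq G e | G <- Gs] j)) //.
  move=> j; rewrite -eu /= nth_cat st sF ltnNge leq_addr /= addKn.
  by rewrite (nth_map (@TConst L V Zero)) // su sG.
move=> i; rewrite -et /= nth_cat st sF ltn_ord.
by rewrite (nth_map (@TConst L V Zero)) // st sF.
Qed.

(** Products of heights become heights of tuples through [height_pair] and [height_pair_scaled]. The
    indices 2 and 6 below stand for 3 and 7 entries. *)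
Lemma pe_ht_le V (F1 F2 G1 G2 : (V -> rat) -> rat) C : (0 < C)%N ->
  term_definable F1 -> term_definable F2 -> term_definable G1 -> term_definable G2 ->
  pe_definable (fun e => (ht (F1 e) * ht (F2 e) <= C * (ht (G1 e) * ht (G2 e)))%N).
Proof.
move=> C0 dF1 dF2 dG1 dG2; have dG := tdefM dG1 dG2; have dC := tdef_nat V C.
have := @pe_height_le V 2 6 [:: F1; F2; (fun e => F1 e * F2 e)]
  [:: G1; G2; (fun e => G1 e * G2 e); (fun e => C%:R); (fun e => C%:R * G1 e);
      (fun e => C%:R * G2 e); (fun e => C%:R * (G1 e * G2 e))] erefl erefl.
case.
- by do 3?[apply: tsdef_cons; first by [|apply: tdefM]]; apply: tsdef_nil.
- by do 7?[apply: tsdef_cons; first by [|apply: tdefM]]; apply: tsdef_nil.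
move=> p pp ep; exists p => // e; rewrite ep /=.
rewrite (height_pair R (F1 e) (F2 e)) (height_pair_scaled R (G1 e) (G2 e) C0).
by rewrite ler_ln ?posrE ?ltr0n ?muln_gt0 ?ht_gt0 ?C0 // ler_nat.
Qed.

End Definability.

(* [o], [s], [d], [u], [l] stand for [1], [x + y], [|x - y|], [z + 1] and
   [|z - 1|]. *)
Lemma mul_via_squares x y z : (exists o, exists s, exists d, exists u, exists l,
  ((o = 1 /\ s = x + y) /\
   ((x = y + d \/ y = x + d) /\ (u = z + o /\ (z = o + l \/ o = z + l)))) /\
  (s ^ 2 + l ^ 2 <= d ^ 2 + u ^ 2 /\ d ^ 2 + u ^ 2 <= s ^ 2 + l ^ 2))%N
  <-> z = (x * y)%N.
Proof.
have key d w : (z = 1 + w \/ 1 = z + w)%N ->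
    forall m, ((d ^ 2 + 4 * m + w ^ 2 = d ^ 2 + (z + 1) ^ 2)%N <-> z = m).
  have w4 : (z = 1 + w \/ 1 = z + w)%N -> ((z + 1) ^ 2 = w ^ 2 + 4 * z)%N.
    case=> [->|e]; first by ring.
    by have [[-> ->]|[-> ->]] : (z = 0 /\ w = 1 \/ z = 1 /\ w = 0)%N by lia.
  by move=> /w4 -> m; lia.
have main d w : (x = y + d \/ y = x + d)%N -> (z = 1 + w \/ 1 = z + w)%N ->
    ((x + y) ^ 2 + w ^ 2 = d ^ 2 + (z + 1) ^ 2)%N <-> z = (x * y)%N.
  move=> xy zw; rewrite -(key d w zw (x * y)%N).
  case: xy => ->.
    by rewrite (_ : (y + d + y) ^ 2 = d ^ 2 + 4 * ((y + d) * y))%N //; ring.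
  by rewrite (_ : (x + (x + d)) ^ 2 = d ^ 2 + 4 * (x * (x + d)))%N //; ring.
split=> [[o [s [d [u [l [[[-> ->] [xy [-> zl]]] [le1 le2]]]]]]]|ez].
  by apply/(main d l xy zl)/eqP; rewrite eqn_leq le1.
have [d xy] : exists d, (x = y + d \/ y = x + d)%N.
  by have [h|h] := leqP y x; [exists (x - y)%N | exists (y - x)%N]; lia.
have [l zl] : exists l, (z = 1 + l \/ 1 = z + l)%N.
  by have [h|h] := leqP 1 z; [exists (z - 1)%N | exists (1 - z)%N]; lia.
have e := proj2 (main d l xy zl) ez.
by exists 1%N, (x + y)%N, d, (z + 1)%N, l; rewrite e leqnn.
Qed.

(** * Arithmetic of codes by positive existential formulas *)

Section Coding.
Variable R : realType.
Notation L := height_language.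
Notation M := (rat_height_structure R).

Definition is_code (u : rat) : Prop := exists n, codes u n.

Definition env_codes (V : Type) (e : V -> rat) (n : V -> nat) : Prop :=
  forall v, codes (e v) (n v).

(* The formula is required to be correct on codes only. *)
Definition nat_definable (V : Type) (S : (V -> nat) -> Prop) : Prop :=
  exists2 p : formula L V, pos_exist p &
    forall (e : V -> M) n, env_codes e n -> realization p e <-> S n.

Lemma pe_quartic V (u v : V) :
  pe_definable R (fun e => e v ^+ 2 = 1 + 8 * e u ^+ 4).
Proof.
apply: pe_eq; first exact/tdefX/tdef_var.
by apply: tdefD; [exact: tdef1 | apply: tdefM; [exact: tdef_nat | exact/tdefX/tdef_var]].
Qed.

Lemma pe_is_code V (u : V) : pe_definable R (fun e => is_code (e u)).
Proof.
apply: (pe_iff (fun e => quartic_codes (e u))).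
by apply: (@pe_ex _ _ (fun e v => v ^+ 2 = 1 + 8 * e u ^+ 4)); apply: pe_quartic.
Qed.

Lemma pe_is_code_seq (V : eqType) (s : seq V) :
  pe_definable R (fun e => forall v, v \in s -> is_code (e v)).
Proof.
elim: s => [|u s IH].
  by apply: (pe_iff _ (pe_eq (tdef0 R V) (tdef0 R V))) => e; split.
apply: (pe_iff _ (pe_and (pe_is_code u) IH)) => e; split=> [[hu hs] v|h].
  by rewrite inE => /orP[/eqP ->|/hs].
by split=> [|v vs]; apply: h; rewrite inE ?eqxx ?vs ?orbT.
Qed.

Lemma nd_pe V (S : (V -> rat) -> Prop) (S' : (V -> nat) -> Prop) :
  (forall e n, env_codes e n -> S e <-> S' n) ->
  pe_definable R S -> nat_definable S'.
Proof. by move=> h [p pp ep]; exists p => // e n en; rewrite ep; apply: h. Qed.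

Lemma pe_and4 V (S1 S2 S3 S4 : (V -> rat) -> Prop) :
  pe_definable R S1 -> pe_definable R S2 -> pe_definable R S3 -> pe_definable R S4 ->
  pe_definable R (fun e => [/\ S1 e, S2 e, S3 e & S4 e]).
Proof.
move=> d1 d2 d3 d4.
apply: (pe_iff _ (pe_and (pe_and d1 d2) (pe_and d3 d4))) => e.
by split=> [[[? ?] [? ?]]|[]].
Qed.

(** Terms have no subtraction, so the negative part is moved to the other side. *)
Lemma pe_mul1B V (F G H : (V -> rat) -> rat) :
  term_definable R F -> term_definable R G -> term_definable R H ->
  pe_definable R (fun e => F e * (1 - G e) = H e).
Proof.
move=> dF dG dH; apply: (pe_iff _ (pe_eq dF (tdefD (tdefM dF dG) dH))) => e.
rewrite mulrBr mulr1; split=> [{1}->|<-]; last by rewrite addrC subrK.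
by rewrite addrAC subrr add0r.
Qed.

Lemma nd_iff V (S S' : (V -> nat) -> Prop) :
  (forall n, S n <-> S' n) -> nat_definable S -> nat_definable S'.
Proof. by move=> h [p pp ep]; exists p => // e n en; rewrite ep. Qed.

Lemma nd_and V (S T : (V -> nat) -> Prop) :
  nat_definable S -> nat_definable T -> nat_definable (fun n => S n /\ T n).
Proof.
move=> [p pp ep] [q pq eq]; exists (FAnd p q) => //= e n en.
by rewrite (ep _ _ en) (eq _ _ en).
Qed.

Lemma nd_or V (S T : (V -> nat) -> Prop) :
  nat_definable S -> nat_definable T -> nat_definable (fun n => S n \/ T n).
Proof.
move=> [p pp ep] [q pq eq]; exists (FOr p q) => //= e n en.
by rewrite (ep _ _ en) (eq _ _ en).
Qed.

(** The rational quantifier is relativized to codes, the guard being itself positive existential;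
    [mulgen m] is the witness for [m]. *)
Lemma nd_ex V (S : (V -> nat) -> nat -> Prop) :
  nat_definable (fun n : option V -> nat => S (fun v => n (Some v)) (n None)) ->
  nat_definable (fun n => exists m, S n m).
Proof.
move=> [p pp ep]; have [d pd ed] := pe_is_code (None : option V).
exists (FEx (FAnd d p)) => //= e n en.
have ext a m : codes a m -> env_codes (extend e a) (extend n m) by move=> ? [].
split=> [[a [/ed[m am] hp]]|[m hS]].
  by exists m; apply/(ep _ _ (ext a m am)).
exists (mulgen m); split; first by apply/ed; exists m; apply: codes_mulgen.
by apply/(ep _ _ (ext _ _ (codes_mulgen m))).
Qed.

Lemma nd_eq V (x y : V) : nat_definable (fun n => n x = n y).
Proof.
apply: (@nd_pe _ (fun e => e x ^+ 2 = e y ^+ 2)); last first.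
  by apply: pe_eq; apply/tdefX/tdef_var.
move=> e n en; split=> h; last by rewrite (eqP (en x)) (eqP (en y)) h.
by apply: (codes_inj R (en x)); rewrite /codes h; apply: en.
Qed.

Lemma nd_zero V (x : V) : nat_definable (fun n => n x = 0).
Proof.
apply: (@nd_pe _ (fun e => e x = 0)); last first.
  by apply: pe_eq; [exact: tdef_var | exact: tdef0].
move=> e n en; split=> h; first by apply: (codes_inj R (en x)); rewrite h.
by have /eqP := en x; rewrite h expr0n /= => /eqP; rewrite sqrf_eq0 => /eqP.
Qed.

Lemma nd_one V (x : V) : nat_definable (fun n => n x = 1).
Proof.
apply: (@nd_pe _ (fun e => e x ^+ 2 = 1)); last first.
  by apply: pe_eq; [exact/tdefX/tdef_var | exact: tdef1].
move=> e n en; split=> h; last by rewrite (eqP (en x)) h.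
by apply: (codes_inj R (en x)); rewrite /codes h.
Qed.

Lemma nd_sum V (x y z : V) : nat_definable (fun n =>
  [\/ n z = n x + n y, n x = n y + n z | n y = n x + n z]%N).
Proof.
apply: (@nd_pe _ (fun e => sum_rel (e x) (e y) (e z))).
  by move=> e n en; apply: sum_rel_codes.
rewrite /sum_rel; do 3!apply: pe_ex; apply: pe_and4.
- exact: pe_quartic.
- exact: pe_quartic.
- by apply: pe_eq; apply/tdefX/tdef_var.
- apply: pe_mul1B; first exact: tdef_var.
    by apply: tdefM; [apply: tdefM; [exact: tdef_nat|]|]; apply/tdefX/tdef_var.
  by apply: tdefD; apply: tdefM; apply: tdef_var.
Qed.

Lemma nd_double V (x y : V) : nat_definable (fun n => n y = 2 * n x)%N.
Proof.
apply: (nd_pe (fun e n en => double_codes R (en x) (en y))).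
(* The trivial equation [0 = 0] fills the fourth place of [pe_and4]. *)
do 2!apply: pe_ex; apply: (@pe_iff _ _
  (fun e => [/\ e (Some None) ^+ 2 = 1 + 8 * e (Some (Some x)) ^+ 4,
     e None ^+ 2 = e (Some (Some y)) ^+ 2,
     e None * (1 - 8 * e (Some (Some x)) ^+ 4) = 2 * e (Some (Some x)) * e (Some None)
   & 0 = 0 :> rat])).
  by move=> e; split=> [[? ? ?]|[? ? ?]]; split.
apply: pe_and4.
- exact: pe_quartic.
- by apply: pe_eq; apply/tdefX/tdef_var.
- apply: pe_mul1B; first exact: tdef_var.
    by apply: tdefM; [exact: tdef_nat | apply/tdefX/tdef_var].
  by apply: tdefM; [apply: tdefM; [exact: tdef_nat|]|]; apply: tdef_var.
- by apply: pe_eq; apply: tdef0.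
Qed.

(** Four doublings are used, since the definition of addition itself relies on this factor 16
    through the order. *)
Lemma nd_mul16 V (x y : V) : nat_definable (fun n => n y = 16 * n x)%N.
Proof.
apply: (@nd_iff _ (fun n => exists a, exists b, exists c,
  [/\ a = 2 * n x, b = 2 * a, c = 2 * b & n y = 2 * c])%N).
  move=> n; split=> [[a [b [c [-> -> -> ->]]]]|->]; first by rewrite !mulnA.
  by exists (2 * n x)%N, (2 * (2 * n x))%N, (2 * (2 * (2 * n x)))%N; rewrite !mulnA.
do 3!apply: nd_ex.
pose S (v : V) := Some (Some (Some v)).
apply: (nd_iff _ (nd_and (nd_and (nd_double (S x) (Some (Some None)))
    (nd_double (Some (Some None)) (Some None)))
  (nd_and (nd_double (Some None) None) (nd_double None (S y))))) => n.
by split=> [[[? ?] [? ?]]|[]].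
Qed.

Lemma nd_sqr_le V (x y z w : V) :
  nat_definable (fun n => n x ^ 2 + n y ^ 2 <= n z ^ 2 + n w ^ 2)%N.
Proof.
apply: (@nd_iff _ (fun n => exists a, exists b, exists c, exists d,
  ((a = 16 * n x /\ b = 16 * n y) /\ (c = 16 * n z /\ d = 16 * n w)) /\
  genht a * genht b <= 9 ^ 4 * (genht c * genht d))%N).
  move=> n; have [h1 h2] := genht_compare R (n x) (n y) (n z) (n w).
  split=> [[a [b [c [d [[[-> ->] [-> ->]]]]]]]|h]; first exact: h2.
  exists (16 * n x)%N, (16 * n y)%N, (16 * n z)%N, (16 * n w)%N; split=> //.
  exact: h1.
do 4!apply: nd_ex; do 3?[apply: nd_and]; try exact: nd_mul16.
apply: (@nd_pe _ (fun e => ht (e (Some (Some (Some None)))) * ht (e (Some (Some None))) <=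
    9 ^ 4 * (ht (e (Some None)) * ht (e None)))%N).
  by move=> e n en; rewrite !(ht_codes (en _)).
by apply: pe_ht_le; [rewrite expn_gt0 | apply: tdef_var..].
Qed.

(** The order selects the sum in [nd_sum]: in the other alternatives, if neither argument exceeds
    [n z], one argument is 0 and the sum relation holds anyway. *)
Lemma nd_add V (x y z : V) : nat_definable (fun n => n z = n x + n y)%N.
Proof.
apply: (nd_iff _ (nd_and (nd_sum x y z)
  (nd_and (nd_sqr_le x x z z) (nd_sqr_le y y z z)))) => n.
have le a b : (a ^ 2 + a ^ 2 <= b ^ 2 + b ^ 2)%N = (a <= b)%N.
  by rewrite !addnn leq_double leq_exp2r.
rewrite !le; split=> [[h [h1 h2]]|->]; first by case: h; lia.
by rewrite leq_addr leq_addl; split=> //; constructor 1.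
Qed.

Lemma nd_mul V (x y z : V) : nat_definable (fun n => n z = n x * n y)%N.
Proof.
apply: (@nd_iff _ (fun n => exists o, exists s, exists d, exists u, exists l,
  ((o = 1 /\ s = n x + n y) /\
   ((n x = n y + d \/ n y = n x + d) /\
    (u = n z + o /\ (n z = o + l \/ o = n z + l)))) /\
  (s ^ 2 + l ^ 2 <= d ^ 2 + u ^ 2 /\ d ^ 2 + u ^ 2 <= s ^ 2 + l ^ 2))%N).
  move=> n; exact: mul_via_squares.
do 5!apply: nd_ex; do ?[apply: nd_and | apply: nd_or];
  first [exact: nd_one | exact: nd_add | exact: nd_sqr_le].
Qed.

(** An interpretation also requires each formula to hold only on the domain; finitely many guards,
    one for each free variable, ensure this. *)
Lemma nd_formula (V : finType) (S : (V -> nat) -> Prop) : nat_definable S ->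
  exists2 p : formula L V, pos_exist p &
    (forall e : V -> M, realization p e -> forall v, is_code (e v)) /\
    (forall (e : V -> M) n, env_codes e n -> S n <-> realization p e).
Proof.
move=> [p pp ep]; have [d pd ed] := pe_is_code_seq (enum V).
exists (FAnd d p) => //=; split=> [e [/ed h _] v|e n en].
  by apply: h; rewrite mem_enum.
rewrite (ep _ _ en) ed; split=> [h|[]//]; split=> // v _.
by exists (n v); apply: en.
Qed.

End Coding.

Theorem theorem1p1 (R : realType) :
  exists (r : nat)
         (I : interpretation nat_structure (rat_height_structure R) r),
    pos_exist_interpretation I.
Proof.
have [dom pdom edom] := @pe_is_code R 'I_1 ord0.
have domP (x : 'I_1 -> rat_height_structure R) :
    realization dom x -> exists n, codes (x ord0) n.
  by move/edom.
(* The decoding map can be chosen because [codes] is decidable, and [codes_inj] makes it independent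
   of the choice. *)
pose th (x : {x : 'I_1 -> rat_height_structure R | realization dom x}) : nat :=
  xchoose (domP _ (proj2_sig x)).
have thP x : codes (proj1_sig x ord0) (th x) by exact: (xchooseP (domP _ (proj2_sig x))).
have th_eq x n : codes (proj1_sig x ord0) n -> th x = n.
  by move=> h; apply: (codes_inj R (thP x) h).
have env1 x : env_codes (proj1_sig x) (fun _ : 'I_1 => th x) by move=> i; rewrite ord1.
have const (S : ('I_1 -> nat) -> Prop) : nat_definable R S ->
    exists2 p : formula height_language 'I_1, pos_exist p &
    (forall x : 'I_1 -> rat_height_structure R, realization p x -> realization dom x) /\
    (forall x, S (fun _ => th x) <-> realization p (proj1_sig x)).
  case/nd_formula => p pp [p1 p2]; exists p => //; split=> [x /p1 h|x].
    exact/edom.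
  exact: p2.
have pred k (S : ('I_k -> nat) -> Prop) :
    nat_definable R (fun n : 'I_k * 'I_1 -> nat => S (fun i => n (i, ord0))) ->
    exists2 p : formula height_language ('I_k * 'I_1), pos_exist p &
    preimage_cond th p S.
  case/nd_formula => p pp [p1 p2]; exists p => //; split=> [x /p1 h i|x].
    by apply/edom; apply: (h (i, ord0)).
  apply: (p2 _ (fun v => th (x v.1))) => -[i j]; rewrite /flat /= ord1.
  exact: thP.
have [p0 pp0 e0] := const _ (nd_zero R (ord0 : 'I_1)).
have [p1 pp1 e1] := const _ (nd_one R (ord0 : 'I_1)).
have [peq ppeq eeq] := pred 2 (@rinterp _ nat_structure Eq)
  (nd_eq R (ord0, ord0) (ord_max, ord0)).
(* [w] places the two arguments among the three coordinates of a graph, the last of which holds the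
   value. *)
pose w (i : 'I_2) : 'I_3 * 'I_1 := (widen_ord (leqnSn 2) i, ord0).
have [padd ppadd eadd] := pred 3 (graph (@finterp _ nat_structure Add))
  (nd_iff (fun n => conj esym esym) (nd_add R (w ord0) (w ord_max) (ord_max, ord0))).
have [pmul ppmul emul] := pred 3 (graph (@finterp _ nat_structure Mul))
  (nd_iff (fun n => conj esym esym) (nd_mul R (w ord0) (w ord_max) (ord_max, ord0))).
unshelve eexists 1%N, (@Interpretation _ _ nat_structure (rat_height_structure R) 1 dom th
  (fun c => match c with Zero => p0 | One => p1 end)
  (fun _ => peq) (fun f => match f with Add => padd | Mul => pmul end) _ _ _ _).
- move=> a; have h : realization dom (fun _ : 'I_1 => mulgen a : rat_height_structure R).
    by apply/edom; exists a; apply: codes_mulgen.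
  by exists (exist _ _ h); apply: th_eq; apply: codes_mulgen.
- by case.
- by case.
- by case.
split=> //; by case.
Qed.
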